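(* Let $X$ be a simple graph on $n$ vertices, let $\mathfrak C$ be the set of all cycle subgraphs of $\mathsf{FS}(X,\text{Star}_n)$ whose length equals $g(\mathsf{FS}(X,\text{Star}_n))$, and let $\mathcal X = \{X_{\mathcal C}\}_{\mathcal C\in\mathfrak C}$. If some $X_{\mathcal C}\in\mathcal X$ has a subgraph isomorphic to a barbell graph, then some member of $\mathcal X$ is a cycle graph or a barbell graph.
   Context: $\text{Star}_n$ is the graph on $[n]$ with center $n$ and edges $\{i,n\}$, $i\in[n-1]$. $\mathsf{FS}(X,Y)$ has as vertices all bijections $\sigma: V(X)\to V(Y)$, with $\sigma,\sigma'$ adjacent iff there is an edge $\{a,b\}\in E(X)$ with $\{\sigma(a),\sigma(b)\}\in E(Y)$, $\sigma'(a)=\sigma(b)$, $\sigma'(b)=\sigma(a)$ and $\sigma'=\sigma$ elsewhere; $g$ denotes girth. For a cycle $\mathcal C$ in $\mathsf{FS}(X,\text{Star}_n)$ with consecutive vertices $\sigma_0,\sigma_1,\dots,\sigma_\lambda=\sigma_0$, the $\mathcal C$-induced subgraph $X_{\mathcal C}$ of $X$ has vertex set $\{v\in V(X): \sigma_i(v)=n \text{ for some } i\}$ and edge set $\{\{v,w\}: \text{for some } i, \sigma_{i-1}(v)=\sigma_i(w) \text{ and } \sigma_{i-1}(w)=\sigma_i(v)\}$. A barbell graph is a graph with subgraphs $\mathcal C_1,\mathcal C_2,\mathcal P$ whose edge sets partition its edges, where either $\mathcal C_1,\mathcal C_2$ are vertex-disjoint cycles and $\mathcal P$ is a path from a vertex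 of $\mathcal C_1$ to a vertex of $\mathcal C_2$ with inner vertices outside both cycles, or $\mathcal C_1,\mathcal C_2$ are cycles sharing exactly one vertex and $\mathcal P$ is the trivial path at that vertex. *)

(* Defs.v *)
From mathcomp Require Import all_boot.

Set Implicit Arguments.
Unset Strict Implicit.
Unset Printing Implicit Defensive.

(* A graph whose vertices form a subset of T. The record itself is raw; see
   [simple] for the well-formedness condition. *)
Record graph (T : finType) := Graph { vset : {set T}; eset : {set {set T}} }.

Definition simple (T : finType) (G : graph T) : Prop :=
  forall e, e \in eset G -> #|e| = 2 /\ e \subset vset G.

Definition graph_of (T : finType) (r : rel T) : graph T :=
  Graph setT [set [set p.1; p.2] | p : T * T & r p.1 p.2].

Definition subgraph (T : finType) (H G : graph T) : Prop :=
  [/\ simple H, vset H \subset vset G & eset H \subset eset G].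

Definition isomorphic (T U : finType) (G : graph T) (H : graph U) : Prop :=
  exists f : T -> U,
    [/\ {in vset G &, injective f},
        f @: vset G = vset H
      & [set f @: (e : {set T}) | e in eset G] = eset H].

(* For repetition-free c of size at least 3; [next] wraps around. *)
Definition cycle_graph (T : finType) (c : seq T) : graph T :=
  Graph [set x in c] [set [set x; next c x] | x in c].

(* The path visiting x :: s in order; [zip] drops the last item of x :: s. *)
Definition path_graph (T : finType) (x : T) (s : seq T) : graph T :=
  Graph [set z in x :: s] [set [set p.1; p.2] | p in zip (x :: s) s].

Definition is_cycle (T : finType) (G : graph T) : Prop :=
  exists c : seq T, [/\ 2 < size c, uniq c & G = cycle_graph c].

Definition is_path (T : finType) (G : graph T) (x y : T) : Prop :=
  exists s : seq T, [/\ uniq (x :: s), last x s = y & G = path_graph x s].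

(* The parts of the edge set may be empty (when P is trivial), so [partition]
   from finset does not apply. *)
Definition is_barbell (T : finType) (G : graph T) : Prop :=
  exists C1 C2 P : graph T,
    [/\ [/\ subgraph C1 G, subgraph C2 G & subgraph P G],
        is_cycle C1 /\ is_cycle C2,
        vset G = vset C1 :|: vset C2 :|: vset P,
        [/\ eset G = eset C1 :|: eset C2 :|: eset P,
            [disjoint eset C1 & eset C2],
            [disjoint eset C1 & eset P]
          & [disjoint eset C2 & eset P]]
      & (exists x y : T,
           [/\ [disjoint vset C1 & vset C2],
               x \in vset C1, y \in vset C2, is_path P x y
             & [disjoint vset P :\: [set x; y] & vset C1 :|: vset C2]])
        \/ (exists x : T,
              vset C1 :&: vset C2 = [set x] /\ P = path_graph x [::])].

Definition cycle_subgraph (T : finType) (C G : graph T) : Prop :=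
  subgraph C G /\ is_cycle C.

Definition cycle_length (T : finType) (C : graph T) : nat := #|eset C|.

(* Relational, so that no number is the girth of a forest. *)
Definition is_girth (T : finType) (G : graph T) (g : nat) : Prop :=
  (exists C, cycle_subgraph C G /\ cycle_length C = g) /\
  (forall C, cycle_subgraph C G -> g <= cycle_length C).

Definition girth_cycle (T : finType) (G C : graph T) : Prop :=
  cycle_subgraph C G /\ is_girth G (cycle_length C).

Definition bij (T U : finType) : finType :=
  {f : {ffun T -> U} | injectiveb f && [forall y, y \in codom f]}.

Definition FS (T U : finType) (X : rel T) (Y : rel U) : rel (bij T U) :=
  fun s t => [exists a, exists b,
    [&& X a b, Y (val s a) (val s b),
        val t a == val s b, val t b == val s a
      & [forall c, (c != a) && (c != b) ==> (val t c == val s c)]]].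

(* 'I_n stands for [n], with i : 'I_n standing for i.+1; the center is n. *)
Definition center (n : nat) (i : 'I_n) : bool := i.+1 == n.

Definition star (n : nat) : rel 'I_n :=
  fun i j => (i != j) && (center i || center j).

(* The condition on v and w is invariant under exchanging s and t, so C needs
   no orientation: {s, t} ranges over the pairs of consecutive vertices. *)
Definition induced (T : finType) (n : nat) (C : graph (bij T 'I_n)) : graph T :=
  Graph [set v | [exists s in vset C, center (val s v)]]
        [set [set p.1; p.2] | p : T * T &
           (p.1 != p.2) &&
           [exists s, exists t,
              [&& [set s; t] \in eset C,
                  val s p.1 == val t p.2 & val s p.2 == val t p.1]]].

(* Main.v *)
(* A cycle of FS(X, Star_n) is a closed non-backtracking walk of the hole (the
   vertex mapped to the center) that restores the configuration; conversely such
   a walk, if it is no longer than the girth, is automatically a girth cycle.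
   Let L be the girth, k the length of a shortest cycle K of X, and take the
   hole walk of a girth cycle.

   If some edge is crossed only once, follow the token crossing it: it goes round
   a closed walk of at least k moves, and two consecutive moves are at least
   k - 1 steps apart, so L >= k(k - 1). Walking k - 1 times around K restores the
   configuration, so it gives a girth cycle inducing K.

   Otherwise every edge is crossed at least twice. Let C1, C2 be the cycles of
   the given barbell and p their distance in X. Each of the p spheres separating
   C1 from C2 is crossed at least four times: if only twice, then along one edge,
   and the excursion in between restores the configuration too early. So
   L >= 2(|C1| + |C2| + 2p). With P a shortest path from C1 to C2, the commutator
   of the closed walks C1 and P C2 P^-1, whose permutations have disjoint
   supports, has exactly that length, and it induces a barbell. *)
Require Import Defs.
From mathcomp Require Import fingroup perm.
From mathcomp Require Import all_boot.
From mathcomp Require Import zify.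

Set Implicit Arguments.
Unset Strict Implicit.
Unset Printing Implicit Defensive.

Lemma set2_eq (T : finType) (a b c d : T) :
  [set a; b] = [set c; d] -> (a = c /\ b = d) \/ (a = d /\ b = c).
Proof.
move=> e.
have := set21 a b; rewrite e !inE => ha.
have := set22 a b; rewrite e !inE => hb.
have := set21 c d; rewrite -e !inE => hc.
have := set22 c d; rewrite -e !inE => hd.
case/orP: ha => /eqP ?; case/orP: hb => /eqP ?; subst; auto.
- by left; split=> //; move: hd; rewrite orbb => /eqP.
- by right; split=> //; move: hc; rewrite orbb => /eqP.
Qed.

(** * Cycles inside closed walks *)

Section Walks.

Variables (V : eqType) (r : rel V).

Lemma cycle_mkseq (w : nat -> V) m :
  w m = w 0 -> (forall i, i < m -> r (w i) (w i.+1)) -> cycle r (mkseq w m).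
Proof.
case: m => [//|m] wm rw.
rewrite /mkseq /= -[X in rcons _ X]wm (iotaDl 1 0) -map_comp.
have -> : rcons [seq (w \o addn 1) i | i <- iota 0 m] (w m.+1) =
          mkseq (fun i => w i.+1) m.+1 by rewrite mkseqS.
apply/(pathP (w 0)) => i; rewrite size_mkseq => im.
rewrite nth_mkseq //; case: i im => [|i] im /=; first exact: rw.
by rewrite nth_mkseq 1?ltnW //; apply: rw.
Qed.

Lemma mkseq_uniq_in (w : nat -> V) m :
  (forall i j, i < j < m -> w i != w j) -> uniq (mkseq w m).
Proof.
move=> wI; apply/(uniqP (w 0)) => i j; rewrite !inE size_mkseq => im jm.
rewrite !nth_mkseq // => /eqP wij; case: (ltngtP i j) => // ij.
- by move: (wI i j); rewrite ij jm wij => /(_ isT).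
- by move: (wI j i); rewrite ij im eq_sym wij => /(_ isT).
Qed.

(** A closed stretch of minimal positive length has distinct vertices. Its length is not 1 because
    [r] is irreflexive, and not 2 because the walk never turns back. *)
Lemma nonbacktracking_closed_cycle (w : nat -> V) L :
    irreflexive r -> 0 < L -> w L = w 0 ->
    (forall i, i < L -> r (w i) (w i.+1)) ->
    (forall i, i.+2 <= L -> w i != w i.+2) ->
  exists i m, [/\ i + m <= L, 2 < m, uniq (mkseq (fun j => w (i + j)) m)
                & cycle r (mkseq (fun j => w (i + j)) m)].
Proof.
move=> irr L0 wL rw nb.
pose P m := (0 < m) && [exists i : 'I_L.+1, (i + m <= L) && (w (i + m) == w i)].
have exP : exists m, P m.
  by exists L; rewrite /P L0; apply/existsP; exists ord0; rewrite add0n leqnn wL /=.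
case: (ex_minnP exP) => m /andP [m0 /existsP [i /andP [imL /eqP wim]]] mmin.
have minm a b : a < b -> b <= L -> w a = w b -> m <= b - a.
  move=> ab bL wab; apply: mmin; rewrite /P subn_gt0 ab /=.
  have aL : a < L.+1 by lia.
  by apply/existsP; exists (Ordinal aL); rewrite /= subnKC ?bL ?wab //= ltnW.
exists i, m; split=> //.
- case: m m0 imL wim mmin minm => [|[|[|m]]] // _ imL wim _ _.
  + by have /= := rw i; rewrite -addn1 wim irr => /(_ imL).
  + by have := nb i; rewrite addn2 in wim imL; rewrite wim eqxx => /(_ imL).
- apply: mkseq_uniq_in => a b /andP [ab bm]; apply/eqP => e.
  have := minm _ _ _ _ e; rewrite ltn_add2l => /(_ ab); lia.
- apply: cycle_mkseq => [|j jm]; first by rewrite addn0.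
  by rewrite addnS; apply: rw; lia.
Qed.

End Walks.

(** * Cycle graphs and path graphs of sequences *)

Section CycleGraph.

Variable T : finType.
Implicit Types (x y z : T) (c s : seq T) (r : rel T) (e : {set T}).

(** The first inequality makes [[set x; next c x]] a genuine pair; the second makes these pairs
    distinct for distinct [x]. *)
Lemma next_neq2 c x : 2 < size c -> uniq c -> x \in c ->
  (x != next c x) /\ (next c (next c x) != x).
Proof.
move=> sc uc xc; case/rot_to: (xc) => i c' e.
have urot : uniq (x :: c') by rewrite -e rot_uniq.
have srot : 2 < size (x :: c') by rewrite -e size_rot.
rewrite -!(next_rot i uc) e.
case: c' urot srot {e} => [|y [|z c']] //=.
rewrite !inE !negb_or => /andP [/andP [xy /andP [xz xc']] /andP [/andP [yz yc'] _]] _.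
have yx : y != x by rewrite eq_sym.
by rewrite eq_refl (negPf yx) eq_refl xy eq_sym xz.
Qed.

Lemma simple_cycle_graph c : 2 < size c -> uniq c -> simple (cycle_graph c).
Proof.
move=> sc uc e /imsetP [x xc ->]; split.
  by rewrite cards2; case: (next_neq2 sc uc xc) => ->.
by apply/subsetP => z; rewrite !inE => /orP [] /eqP -> //; rewrite mem_next.
Qed.

Lemma card_cycle_graph c :
  2 < size c -> uniq c -> cycle_length (cycle_graph c) = size c.
Proof.
move=> sc uc; rewrite /cycle_length /= card_in_imset.
  by apply/card_uniqP.
move=> x y xc yc /= /set2_eq [[]//|[xy yx]].
by case: (next_neq2 sc uc xc) => _; rewrite yx -xy eqxx.
Qed.

Lemma mem_graph_of r x y :
  symmetric r -> ([set x; y] \in eset (graph_of r)) = r x y.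
Proof.
move=> sr; apply/imsetP/idP => [[[a b]]|rxy]; last first.
  by exists (x, y); rewrite ?inE.
rewrite inE /= => rab /set2_eq [] [-> ->] //; last by rewrite sr.
Qed.

Lemma cycle_eset c (E : {set {set T}}) : uniq c ->
  (eset (cycle_graph c) \subset E) = cycle (fun x y => [set x; y] \in E) c.
Proof.
move=> uc; apply/subsetP/idP => [sE|cE e /imsetP [x xc ->]].
  by apply: cycle_from_next => // x xc; apply: sE; apply: imset_f.
exact: (next_cycle cE).
Qed.

Lemma cycle_subgraph_of r c : symmetric r ->
    2 < size c -> uniq c -> cycle r c ->
  cycle_subgraph (cycle_graph c) (graph_of r).
Proof.
move=> sr sc uc rc; split; last by exists c.
split; [exact: simple_cycle_graph|exact: subsetT|].
rewrite cycle_eset //; apply: sub_cycle rc => x y.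
by rewrite mem_graph_of.
Qed.

Lemma cycle_subgraph_inv r C : symmetric r -> cycle_subgraph C (graph_of r) ->
  exists c, [/\ C = cycle_graph c, 2 < size c, uniq c & cycle r c].
Proof.
move=> sr [[_ _ sE] [c [sc uc e]]]; exists c; split=> //; move: sE.
rewrite e cycle_eset //; apply: sub_cycle => x y.
by rewrite mem_graph_of.
Qed.

Lemma next_mkseq (w : nat -> T) L i :
  uniq (mkseq w L) -> w L = w 0 -> i < L -> next (mkseq w L) (w i) = w i.+1.
Proof.
move=> uw wL iL; have wi : w i \in mkseq w L by apply: map_f; rewrite mem_iota.
have ei : index (w i) (mkseq w L) = i.
  by rewrite -{1}(nth_mkseq (w 0) w iL) index_uniq // size_mkseq.
rewrite next_nth wi ei; case: L uw wL iL {wi ei} => [//|L] uw wL iL.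
rewrite /mkseq /= (iotaDl 1 0) -map_comp -/(mkseq (w \o addn 1) L).
have [iL'|iL'] := ltnP i L; first by rewrite nth_mkseq.
(* At the last index [nth] overruns the tail and returns its default, the head [w 0], which equals
   [w L]. *)
have -> : i = L by lia.
by rewrite nth_default ?wL // size_mkseq.
Qed.

Lemma mem_eset_mkseq (w : nat -> T) L e :
    uniq (mkseq w L) -> w L = w 0 ->
  reflect (exists2 i, i < L & e = [set w i; w i.+1])
          (e \in eset (cycle_graph (mkseq w L))).
Proof.
move=> uw wL; apply: (iffP imsetP) => [[x /mapP [i]]|[i iL ->]].
  rewrite mem_iota add0n => /= iL -> ->; exists i => //.
  by rewrite next_mkseq.
exists (w i); last by rewrite next_mkseq.
by apply: map_f; rewrite mem_iota.
Qed.

Lemma mem_path_eset x s e :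
  reflect (exists2 i, i < size s & e = [set nth x (x :: s) i; nth x s i])
          (e \in eset (path_graph x s)).
Proof.
apply: (iffP imsetP) => [[p /(nthP (x, x)) [i]]|[i si ->]].
  rewrite size_zip /= => si <- ->.
  exists i; first by lia.
  by rewrite nth_zip_cond size_zip /= ifT.
exists (nth x (x :: s) i, nth x s i) => //; apply/(nthP (x, x)); exists i.
  by rewrite size_zip /=; lia.
by rewrite nth_zip_cond size_zip /= ifT //; lia.
Qed.

Lemma path_eset_cons x y s :
  eset (path_graph x (y :: s)) = [set x; y] |: eset (path_graph y s).
Proof.
apply/setP => e; rewrite in_setU1; apply/imsetP/predU1P => [[p]|].
  rewrite inE => /predU1P [-> ->|ps ->]; first by left.
  by right; apply/imsetP; exists p.
case=> [->|/imsetP [p ps ->]]; first by exists (x, y); rewrite // mem_head.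
by exists p; rewrite // inE ps orbT.
Qed.

Lemma path_eset_nil x : eset (path_graph x [::]) = set0.
Proof. by apply/setP => e; rewrite inE; apply/imsetP => [[p]]. Qed.

Lemma path_eset_cat x s1 s2 :
  eset (path_graph x (s1 ++ s2)) =
    eset (path_graph x s1) :|: eset (path_graph (last x s1) s2).
Proof.
elim: s1 x => [|y s1 IH] x; first by rewrite path_eset_nil set0U.
by rewrite cat_cons !path_eset_cons IH setUA.
Qed.

Lemma path_eset_rcons x s y :
  eset (path_graph x (rcons s y)) = [set last x s; y] |: eset (path_graph x s).
Proof.
by rewrite -cats1 path_eset_cat path_eset_cons path_eset_nil setU0 setUC.
Qed.

(** [rev (belast x s)] lists the reversed walk after its starting vertex [last x s]. *)
Lemma path_eset_rev x s :
  eset (path_graph (last x s) (rev (belast x s))) = eset (path_graph x s).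
Proof.
elim: s x => [//|y s IH] x.
rewrite [last x _]/= [belast _ _]/= rev_cons path_eset_rcons IH path_eset_cons; congr (_ |: _).
case: s {IH} => [|z s] /=; first by rewrite setUC.
by rewrite rev_cons last_rcons setUC.
Qed.

Lemma path_eset_closed x s : uniq (x :: s) ->
  eset (path_graph x (rcons s x)) = eset (cycle_graph (x :: s)).
Proof.
move=> us; apply/setP => e.
have ms := mkseq_nth x (x :: s).
have /mem_eset_mkseq memc : uniq (mkseq (nth x (x :: s)) (size (x :: s))).
  by rewrite ms.
apply/mem_path_eset/idP => [[i]|].
  rewrite size_rcons -rcons_cons !nth_rcons_default => si ->.
  by rewrite -[X in cycle_graph X]ms; apply/memc; [rewrite nth_default|exists i].
rewrite -[X in cycle_graph X]ms => /memc; rewrite nth_default // => /(_ erefl) [i si ->].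
by exists i; rewrite ?size_rcons // -rcons_cons !nth_rcons_default.
Qed.

Lemma simple_path_graph x s : uniq (x :: s) -> simple (path_graph x s).
Proof.
elim: s x => [|y s IH] x us e; first by rewrite path_eset_nil inE.
rewrite path_eset_cons => /setU1P [->|].
  split; first by case/andP: us; rewrite cards2 inE negb_or => /andP [->].
  by apply/subsetP => z; rewrite !inE => /orP [] ->; rewrite ?orbT.
move=> /IH; case/andP: us => _ us /(_ us) [e2 es]; split=> //.
by apply: subset_trans es _; apply/subsetP => z; rewrite !inE => ->; rewrite orbT.
Qed.

Lemma disjoint_eset (G H : graph T) x :
    simple G -> simple H -> vset G :&: vset H \subset [set x] ->
  [disjoint eset G & eset H].
Proof.
move=> sG sH GH; apply/pred0P => e; apply/negbTE/negP => /andP [eG eH].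
have [e2 sub1] := sG e eG; have [_ sub2] := sH e eH.
have /subset_leq_card : e \subset [set x].
  by apply: subset_trans GH; rewrite subsetI sub1.
by rewrite cards1 e2.
Qed.

End CycleGraph.

(** * Permutations effected by a walk of the hole *)

Section HolePerm.

Variable T : finType.
Implicit Types (x y z : T) (s : seq T).

(** After the hole has walked along [x :: s], the label at [z] is the one that was at
    [hole_perm x s z]. Labels are thus looked up backwards in time, so the product applies the last
    swap first. *)
Fixpoint hole_perm (x : T) (s : seq T) : {perm T} :=
  if s is y :: s' then (hole_perm y s' * tperm x y)%g else 1%g.

Lemma hole_perm_cat x s1 s2 :
  hole_perm x (s1 ++ s2) = (hole_perm (last x s1) s2 * hole_perm x s1)%g.
Proof.
by elim: s1 x => [|y s1 IH] x /=; rewrite ?mulg1 // IH mulgA.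
Qed.

Lemma hole_perm_rcons x s y :
  hole_perm x (rcons s y) = (tperm (last x s) y * hole_perm x s)%g.
Proof. by rewrite -cats1 hole_perm_cat /= mul1g. Qed.

Lemma hole_perm_rev x s :
  hole_perm (last x s) (rev (belast x s)) = ((hole_perm x s)^-1)%g.
Proof.
elim: s x => [|y s IH] x /=; first by rewrite invg1.
rewrite rev_cons hole_perm_rcons IH invMg tpermV; congr (_ * _)%g.
case: s {IH} => [|z s] /=; first by rewrite tpermC.
by rewrite rev_cons last_rcons tpermC.
Qed.

Lemma hole_perm_last x s : hole_perm x s (last x s) = x.
Proof.
by elim: s x => [|y s IH] x /=; rewrite ?perm1 // permM IH tpermR.
Qed.

Lemma hole_perm_out x s z : z \notin x :: s -> hole_perm x s z = z.
Proof.
elim: s x => [|y s IH] x; rewrite ?perm1 // inE negb_or => /andP [zx zs] /=.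
by rewrite permM IH // tpermD // eq_sym //; case/norP: zs.
Qed.

Lemma hole_perm_take x s i : i < size s ->
  hole_perm x (take i.+1 s) =
    (tperm (nth x (x :: s) i) (nth x s i) * hole_perm x (take i s))%g.
Proof.
move=> si; rewrite (take_nth x) // hole_perm_rcons; congr (tperm _ _ * _)%g.
case: i si => [|i] si; first by rewrite take0.
by rewrite (take_nth x) 1?ltnW // last_rcons.
Qed.

Lemma hole_perm_nth x s i : uniq (x :: s) -> i < size s ->
  hole_perm x s (nth x (x :: s) i) = nth x s i.
Proof.
elim: s x i => [//|y s IH] x i us si; have /= /andP [xys uys] := us.
rewrite permM; case: i si => [|i] si.
  by rewrite hole_perm_out ?tpermL.
have -> : nth x (x :: y :: s) i.+1 = nth y (y :: s) i.
  by rewrite /=; apply: set_nth_default; apply: ltnW.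
have -> : nth x (y :: s) i.+1 = nth x s i by [].
rewrite IH //.
have -> : nth y s i = nth x s i by apply: set_nth_default.
have ins : nth x s i \in s by apply: mem_nth.
rewrite tpermD //; apply: contraTneq ins => <-.
- by move: xys; rewrite inE => /norP [].
- by case/andP: uys.
Qed.

(** The walk out to [last x s] shifts each token by one place, and the closing swap brings the hole
    back to [x]. One turn therefore rotates the tokens on [s] among themselves, skipping [x]. *)
Lemma hole_perm_around x s z : uniq (x :: s) -> z \in s ->
  hole_perm x (rcons s x) z = next s z.
Proof.
move=> us zs; have [xs us'] := andP us.
rewrite hole_perm_rcons permM next_nth zs.
have zi : z = nth x s (index z s) by rewrite nth_index.
have zl : (index z s < size s)%N by rewrite index_mem.
have [zlast|zlast] := eqVneq z (last x s).
  rewrite -zlast tpermL.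
  have -> : index z s = (size s).-1.
    by rewrite zlast -nth_last index_uniq // ltn_predL; case: (s) zs.
  have := @hole_perm_nth x s 0 us; case: (s) zs => //= y p _ -> //.
  by rewrite nth_default.
rewrite tpermD 1?eq_sym //; last by apply: contraNneq xs => <-.
have zl' : (index z s).+1 < size s.
  rewrite ltn_neqAle zl andbT; apply: contra zlast => /eqP e.
  by rewrite -nth_last -e /= nth_index.
rewrite {1}zi -[nth x s _]/(nth x (x :: s) (index z s).+1) hole_perm_nth //.
by case: (s) zl' => // y p zl' /=; apply: set_nth_default.
Qed.

Lemma hole_perm_closed_on x s :
  perm_on [set z in s] (hole_perm x (rcons s x)).
Proof.
apply/subsetP => z; rewrite !inE; apply: contraR => zs.
have [->|zx] := eqVneq z x; last first.
  by rewrite hole_perm_out // inE mem_rcons inE !negb_or zx.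
by have := hole_perm_last x (rcons s x); rewrite last_rcons => ->.
Qed.

(** One turn acts on [s] as a single cycle of length [size s] and fixes every other vertex, [x]
    included. *)
Lemma hole_perm_around_order x s : uniq (x :: s) ->
  (hole_perm x (rcons s x) ^+ size s = 1)%g.
Proof.
move=> us; have [_ us'] := andP us.
have fc : fcycle (hole_perm x (rcons s x)) s.
  apply: cycle_from_next => // z zs.
  by rewrite /= hole_perm_around.
apply/perm.permP => z; rewrite perm1 permX; have [zs|zs] := boolP (z \in s).
  by rewrite -(order_cycle fc us' zs) (iter_order_cycle fc).
have fz : hole_perm x (rcons s x) z = z.
  by apply: out_perm (hole_perm_closed_on x s) _; rewrite inE.
by elim: (size s) => //= m ->.
Qed.

End HolePerm.

(** * Nonbacktracking sequences *)

Section Nonbacktracking.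

Variable T : eqType.
Implicit Types (x y z u v : T) (s : seq T).

Lemma last_mem x s : s != [::] -> last x s \in s.
Proof. by case: s => //= y s _; apply: mem_last. Qed.

Lemma head_mem x s y : s != [::] -> head x (rcons s y) \in s.
Proof. by case: s => //= z s _; apply: mem_head. Qed.

Lemma head_rcons_mem x s y t : s != [::] -> head x (rcons s y ++ t) \in s.
Proof. by case: s => //= z s _; apply: mem_head. Qed.

Fixpoint nonbacktracking (s : seq T) : bool :=
  if s is x :: s' then
    (if s' is _ :: z :: _ then x != z else true) && nonbacktracking s'
  else true.

Lemma nonbacktracking_nth x0 s :
  nonbacktracking s <->
  forall i, i.+2 < size s -> nth x0 s i != nth x0 s i.+2.
Proof.
elim: s => [|x [|y [|z s]] IH]; try by split.
split=> [/andP [xz /IH nb] [|i] // si|nb]; first exact: nb.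
by apply/andP; split; [apply: (nb 0)|apply/IH => i; apply: (nb i.+1)].
Qed.

Lemma nonbacktracking_rev s : nonbacktracking (rev s) = nonbacktracking s.
Proof.
suff sub s' : nonbacktracking s' -> nonbacktracking (rev s').
  by apply/idP/idP => /sub //; rewrite revK.
case: s' => [//|x s'] /(nonbacktracking_nth x) nb.
apply/(nonbacktracking_nth x) => i; rewrite size_rev => si.
rewrite !nth_rev; try lia; rewrite eq_sym.
have -> : size (x :: s') - i.+1 = (size (x :: s') - i.+3).+2 by lia.
by apply: nb; lia.
Qed.

Lemma nonbacktracking_uniq s : uniq s -> nonbacktracking s.
Proof.
elim: s => [//|x s IH] /= /andP [xs us]; rewrite IH // andbT.
case: s xs {us IH} => [|y [|z s]] //.
by rewrite !inE !negb_or => /and3P [].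
Qed.

(** Gluing at [x] creates just one new triple, the one centred at [x]; the last hypothesis forbids
    turning back there. *)
Lemma nonbacktracking_cat x s1 s2 :
    nonbacktracking (rcons s1 x) -> nonbacktracking (x :: s2) ->
    last x s1 != head x s2 ->
  nonbacktracking (s1 ++ x :: s2).
Proof.
elim: s1 => [//|u [|v s1] IH]; first by case: s2 {IH} => //= v s2 _ -> ->.
move=> /= /andP [uz nb1] nb2 l; apply/andP; split; last exact: IH.
by case: s1 uz {IH nb1 l}.
Qed.

Lemma nonbacktracking_closed x s : uniq (x :: s) -> 1 < size s ->
  nonbacktracking (x :: rcons s x).
Proof.
case/lastP: s => [//|s u]; rewrite size_rcons => us s1.
rewrite -cats1 cat_rcons -cat_cons; apply: nonbacktracking_cat => //.
  by rewrite rcons_cons; apply: nonbacktracking_uniq.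
case: s us s1 => [//|y s] us _ /=; apply: contraTneq us => e.
have xs : x \in y :: s by rewrite -e mem_last.
by rewrite cons_uniq mem_rcons in_cons xs orbT.
Qed.

Lemma nonbacktracking_closed_cat x s1 s2 :
    nonbacktracking (x :: rcons s1 x) -> nonbacktracking (x :: s2) ->
    last x s1 != head x s2 ->
  nonbacktracking (x :: rcons s1 x ++ s2).
Proof. by move=> nb1 nb2 l; rewrite cat_rcons -cat_cons; apply: nonbacktracking_cat. Qed.

End Nonbacktracking.

(** * Moves of the hole in [FS X (@star n)] *)

Section StarMoves.

Variables (n : nat) (T : finType) (X : rel T).
Hypotheses (symX : symmetric X) (irrX : irreflexive X).

Local Notation conf := (bij T 'I_n).
Local Notation F := (FS X (@star n)).
Implicit Types (s t : conf) (u v z : T).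

Lemma center_inj (i j : 'I_n) : center i -> center j -> i = j.
Proof. by move=> /eqP ei /eqP ej; apply/val_inj/succn_inj; rewrite /= ei ej. Qed.

Lemma conf_inj s : injective (val s).
Proof. by case/andP: (valP s) => /injectiveP. Qed.

Lemma conf_eq s t : (forall z, val s z = val t z) -> s = t.
Proof. by move=> e; apply/val_inj/ffunP. Qed.

Lemma hole_inj s u v : center (val s u) -> center (val s v) -> u = v.
Proof. by move=> su sv; apply/(@conf_inj s)/center_inj. Qed.

Lemma FS_sym : symmetric F.
Proof.
suff sub s t : F s t -> F t s by move=> s t; apply/idP/idP; apply: sub.
case/existsP => a /existsP [b /and5P [Xab Yab /eqP ta /eqP tb /forallP tc]].
apply/existsP; exists a; apply/existsP; exists b.
rewrite Xab ta tb !eqxx !andTb; apply/andP; split.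
  by case/andP: Yab => ne; rewrite /star eq_sym ne orbC.
apply/forallP => c; apply/implyP => cab.
by rewrite eq_sym; apply: (implyP (tc c)).
Qed.

Lemma FS_irr : irreflexive F.
Proof.
move=> s; apply/negbTE/negP; case/existsP=> a /existsP [b /and5P [Xab _ /eqP sab _ _]].
by move/conf_inj: sab => ab; rewrite ab irrX in Xab.
Qed.

Lemma FS_swap s t u v : center (val s u) -> X u v ->
  (forall z, val t z = val s (tperm u v z)) -> F s t.
Proof.
move=> su Xuv tz; apply/existsP; exists u; apply/existsP; exists v.
rewrite Xuv !tz tpermL tpermR !eqxx /star su orTb andbT !andTb.
apply/andP; split.
  by apply: contraTneq Xuv => /conf_inj ->; rewrite irrX.
apply/forallP => c; apply/implyP => /andP [cu cv].
by rewrite tz tpermD // eq_sym.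
Qed.

(** One of the two exchanged labels is the center of the star, so the exchanged positions are the
    old and the new position of the hole. *)
Lemma FS_inv s t u v : F s t -> center (val s u) -> center (val t v) ->
  X u v /\ forall z, val t z = val s (tperm u v z).
Proof.
case/existsP => a /existsP [b /and5P [Xab Yab /eqP ta /eqP tb /forallP tc]] su tv.
have t_swap z : val t z = val s (tperm a b z).
  case: tpermP => [->|->|/eqP za /eqP zb] //; apply/eqP.
  by apply: (implyP (tc z)); rewrite za zb.
suff [[eu ev]|[eu ev]] : u = a /\ v = b \/ u = b /\ v = a.
- by rewrite eu ev.
- by rewrite eu ev symX; split=> // z; rewrite tpermC.
case/andP: Yab => _ /orP [ca|cb].
- left; split; first exact: hole_inj su ca.
  by apply: (hole_inj tv); rewrite tb.
- right; split; first exact: hole_inj su cb.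
  by apply: (hole_inj tv); rewrite ta.
Qed.

Definition hole_walk (L : nat) (w : nat -> conf) (h : nat -> T) : Prop :=
  [/\ forall i, i <= L -> center (val (w i) (h i)),
      forall i, i < L -> X (h i) (h i.+1)
    & forall i z, i < L -> val (w i.+1) z = val (w i) (tperm (h i) (h i.+1) z)].

Lemma hole_walk_FS L w h i : hole_walk L w h -> i < L -> F (w i) (w i.+1).
Proof.
case=> hc hX hw iL; apply: FS_swap (hX i iL) _; first exact/hc/ltnW.
by move=> z; apply: hw.
Qed.

(** Swapping the same pair twice cancels, so the configurations backtrack exactly where the hole
    does. *)
Lemma hole_walk_return L w h i :
    hole_walk L w h -> i.+2 <= L -> (w i == w i.+2) = (h i == h i.+2).
Proof.
case=> hc hX hw iL; apply/eqP/eqP => e; last first.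
  apply: conf_eq => z; rewrite (hw i.+1) // (hw i) 1?ltnW // -e.
  by rewrite [tperm _ (h i)]tpermC tpermK.
by apply: (@hole_inj (w i)); [apply: hc; lia|rewrite e; apply: hc].
Qed.

(** This reads the induced subgraph off the walk of the hole: its vertices are the positions and its
    edges are the steps. *)
Lemma induced_hole_walk L w h :
    hole_walk L w h -> uniq (mkseq w L) -> w L = w 0 ->
  induced (cycle_graph (mkseq w L)) =
    Graph [set v in mkseq h L] [set e in mkseq (fun i => [set h i; h i.+1]) L].
Proof.
move=> [hc hX hw] uw wL; rewrite /induced; congr Graph.
  apply/setP => v; rewrite !inE; apply/existsP/mapP => [[s]|[i]].
    rewrite inE => /andP [/mapP [i iL ->] cv]; exists i => //.
    by rewrite mem_iota in iL; apply: hole_inj cv (hc _ _); rewrite ltnW.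
  rewrite mem_iota => /= iL ->; exists (w i); rewrite inE hc 1?ltnW // andbT.
  by apply: map_f; rewrite mem_iota.
apply/setP => e; rewrite inE; apply/imsetP/mapP => [[[a b]]|[i]]; last first.
  rewrite mem_iota => /= iL ->; exists (h i, h i.+1) => //; rewrite inE /=.
  apply/andP; split.
    by apply: contraTneq (hX _ iL) => <-; rewrite irrX.
  apply/existsP; exists (w i); apply/existsP; exists (w i.+1).
  rewrite !hw // tpermL tpermR !eqxx !andbT.
  by apply/mem_eset_mkseq => //; exists i.
rewrite inE /= => /andP [ab /existsP [s /existsP [t]]].
case/and3P => /mem_eset_mkseq - /(_ uw wL) [i iL st] /eqP sa /eqP sb ->.
exists i; rewrite ?mem_iota //.
suff [ea eb] : a = tperm (h i) (h i.+1) b /\ b = tperm (h i) (h i.+1) a.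
  move: ab; rewrite ea; case: tpermP => [->|->|]; rewrite ?eqxx //.
  by rewrite setUC.
case/set2_eq: st => [] [es et]; rewrite {}es {}et !hw // in sa sb.
- by split; [apply: conf_inj sa|apply: conf_inj sb].
- by split; apply/esym; [apply: conf_inj sb|apply: conf_inj sa].
Qed.

Definition conf_perm (s : conf) (p : {perm T}) : {ffun T -> 'I_n} :=
  [ffun v => val s (p v)].

Lemma conf_permP s p :
  injectiveb (conf_perm s p) && [forall y, y \in codom (conf_perm s p)].
Proof.
apply/andP; split.
  by apply/injectiveP => a b; rewrite !ffunE => /conf_inj /perm_inj.
apply/forallP => y; case/andP: (valP s) => _ /forallP /(_ y) /codomP [v ->].
by apply/codomP; exists (p^-1 v)%g; rewrite ffunE permKV.
Qed.

Definition act_conf s p : conf := Sub (conf_perm s p) (conf_permP s p).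

Lemma act_confE s p z : val (act_conf s p) z = val s (p z).
Proof. by rewrite SubK ffunE. Qed.

(** The configurations along the walk form a closed nonbacktracking walk of [FS], which contains a
    cycle. That cycle has length at least [g] and the walk has length at most [g], so the cycle is
    the whole walk. *)
Lemma closed_walk_girth_cycle s0 u0 g x (s : seq T) :
    center (val s0 u0) -> is_girth (graph_of F) g ->
    path X x s -> last x s = x -> 0 < size s <= g ->
    nonbacktracking (x :: s) -> hole_perm x s = 1%g ->
  exists C, girth_cycle (graph_of F) C /\
    induced C = Graph [set z in s] (eset (path_graph x s)).
Proof.
move=> c0 girthg Xs sx /andP [s_gt0 sg] nb s1.
pose h i := nth x (x :: s) i.
(* The factor [tperm u0 x] moves the hole of [s0] from [u0] to the start [x]. *)
pose w i := act_conf s0 (hole_perm x (take i s) * tperm u0 x)%g.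
have hw : hole_walk (size s) w h.
  split=> [i si|i si|i z si].
  - rewrite act_confE permM.
    have -> : h i = last x (take i s).
      rewrite /h; case: i si => [|i] si; first by rewrite take0.
      by rewrite (take_nth x) // last_rcons.
    by rewrite hole_perm_last tpermR.
  - exact: (pathP x Xs).
  - by rewrite !act_confE hole_perm_take // !permM.
have wL : w (size s) = w 0 by rewrite /w take_size take0 s1.
have [i [m [im m2 um cm]]] : exists i m, [/\ i + m <= size s, 2 < m,
    uniq (mkseq (fun j => w (i + j)) m) & cycle F (mkseq (fun j => w (i + j)) m)].
  apply: nonbacktracking_closed_cycle => //; first exact: FS_irr.
    by move=> i; apply: hole_walk_FS hw.
  move=> i iL; rewrite (hole_walk_return hw iL).
  exact: (proj1 (nonbacktracking_nth x _) nb).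
have gm : g <= m.
  case: girthg => _ /(_ (cycle_graph (mkseq (fun j => w (i + j)) m))).
  rewrite card_cycle_graph ?size_mkseq //; apply.
  by apply: cycle_subgraph_of; rewrite ?size_mkseq //; apply: FS_sym.
have em : m = size s by lia.
have ei : i = 0 by lia.
subst i m; have gs : g = size s by lia.
have {}um : uniq (mkseq w (size s)) by [].
exists (cycle_graph (mkseq w (size s))); split.
  split; last by rewrite card_cycle_graph ?size_mkseq // -gs.
  by apply: cycle_subgraph_of; rewrite ?size_mkseq //; apply: FS_sym.
rewrite (induced_hole_walk hw) //; congr Graph; apply/setP => e; rewrite inE.
  (* The first [size s] values of [h] are [x] followed by [s] without its last entry, and that entry
     is again [x]. *)
  rewrite inE; apply/mapP/idP => [[i]|es].
    rewrite mem_iota /h => /= si ->; case: i si => [|i] si /=.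
      by rewrite -sx; case: (s) s_gt0 => //= a l _; apply: mem_last.
    by apply: mem_nth; apply: ltnW.
  have [|ne] := eqVneq (index e s).+1 (size s).
    move=> ei; exists 0; rewrite ?mem_iota //.
    have : e = nth x s (size s).-1 by rewrite -ei nth_index.
    by rewrite nth_last sx.
  exists (index e s).+1; last by rewrite /h /= nth_index.
  by rewrite mem_iota /= add0n ltn_neqAle ne index_mem.
by apply/mapP/mem_path_eset => [] [i si ->]; exists i; rewrite ?mem_iota in si *.
Qed.

End StarMoves.

(** * Girth cycles from rotations and from commutators *)

Section ClosedWalks.

Variables (n : nat) (T : finType) (X : rel T).
Hypotheses (symX : symmetric X) (irrX : irreflexive X).
Variables (s0 : bij T 'I_n) (u0 : T) (g : nat).
Hypotheses (center_u0 : center (val s0 u0))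
           (girth_g : is_girth (graph_of (FS X (@star n))) g).
Implicit Types (x y : T) (s c : seq T).

Local Notation girth_cycle_FS := (girth_cycle (graph_of (FS X (@star n)))).

(** With [c = x :: s], a turn rotates [size s] tokens, so [size s] turns restore the configuration;
    they take [size c * (size c).-1] steps. *)
Lemma rotation_girth_cycle c :
    2 < size c -> uniq c -> cycle X c -> size c * (size c).-1 <= g ->
  exists C, girth_cycle_FS C /\ is_cycle (induced C).
Proof.
case: c => [//|x s]; rewrite /= ltnS => s1 us Xs sg.
(* [a] is one turn around the cycle from [x], and [f m] is [m] turns. *)
pose a := rcons s x; pose f m := flatten (nseq m a).
have fS m : f m.+1 = a ++ f m by [].
have lastf m : last x (f m) = x by elim: m => //= m IH; rewrite last_cat last_rcons.
have sizef m : size (f m) = size a * m.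
  by elim: m => [|m IH]; rewrite ?muln0 // fS size_cat IH mulnS.
have sf : 0 < size (f (size s)) <= g.
  by rewrite sizef /a size_rcons sg muln_gt0 /= andbT; lia.
have Xf m : path X x (f m) by elim: m => //= m IH; rewrite cat_path Xs last_rcons.
have nbf m : nonbacktracking (x :: f m).
  elim: m => // m IH; rewrite fS; apply: nonbacktracking_closed_cat => //.
    exact: nonbacktracking_closed.
  (* Between two turns the hole reaches [x] from the last entry of [s] and leaves for the first;
     these differ because [s] has at least two entries. *)
  have hs : last x s != head x s.
    case: s s1 us {IH Xs sg a f fS lastf sizef sf Xf} => [//|y [//|z s]] _.
    rewrite /= => /and3P [_ ys _].
    by apply: contraNneq ys => <-; rewrite mem_last.
  case: m {IH} => [|m]; last first.
    by rewrite fS /a; case: (s) hs.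
  apply: contraTneq us => /= e; rewrite negb_and negbK -{1}e last_mem //.
  by case: (s) s1.
have permf m : hole_perm x (f m) = (hole_perm x a ^+ m)%g.
  by elim: m => // m IH; rewrite fS hole_perm_cat last_rcons IH expgSr.
have esf m : eset (path_graph x (f m.+1)) = eset (path_graph x a).
  elim: m => [|m IH]; first by rewrite /f /= cats0.
  by rewrite fS path_eset_cat last_rcons IH setUid.
have msf m : f m.+1 =i x :: s.
  elim: m => [|m IH] z; first by rewrite /f /= cats0 mem_rcons.
  by rewrite fS mem_cat IH mem_rcons orbb.
have [C [gC iC]] := closed_walk_girth_cycle irrX center_u0 girth_g
  (Xf _) (lastf _) sf (nbf _) (etrans (permf _) (hole_perm_around_order us)).
exists C; split=> //; exists (x :: s); split=> //; rewrite iC.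
case: (size s) s1 => // m _; rewrite esf path_eset_closed //; congr Graph.
by apply/setP => z; rewrite !inE msf inE.
Qed.

(** The cycles are [x :: s1] and [y :: s2], joined by the path [x :: s]; an empty [s] makes them
    share [x = y]. The bound on [g] is the length of the commutator walk. *)
Lemma barbell_girth_cycle x s1 s s2 (y := last x s) :
    uniq (x :: s1 ++ s ++ s2) -> 1 < size s1 -> 1 < size s2 ->
    cycle X (x :: s1) -> cycle X (y :: s2) -> path X x s ->
    2 * ((size s1).+1 + (size s2).+1 + 2 * size s) <= g ->
  exists C, girth_cycle_FS C /\ is_barbell (induced C).
Proof.
move=> uall l1 l2 X1 X2 Xs sg.
have: uniq (x :: s1 ++ s ++ s2) by [].
rewrite /= !cat_uniq !mem_cat !has_cat !negb_or.
case/and5P => /and3P [x1 xs x2] u1 /andP [d1s d12] us /andP [ds2 u2].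
have ys : y \in x :: s by apply: mem_last.
have y2 : y \notin s2.
  move: ys; rewrite inE => /orP [/eqP -> //|ys].
  by apply: contra ds2 => y2; apply/hasP; exists y.
have y1 : y \notin s1.
  move: ys; rewrite inE => /orP [/eqP -> //|ys].
  by apply: contra d1s => y2'; apply/hasP; exists y.
have uc1 : uniq (x :: s1) by rewrite /= x1.
have uc2 : uniq (y :: s2) by rewrite /= y2.
have ucs : uniq (x :: s) by rewrite /= xs.
(* [a] is the loop round the first cycle; [rcons b0 x] goes along [s] to [y], round the second cycle
   and back to [x]. *)
pose a := rcons s1 x; pose b0 := s ++ s2 ++ rev s.
have b0E : rcons b0 x = s ++ rcons s2 y ++ rev (belast x s).
  by rewrite /b0 !rcons_cat cat_rcons -rev_cons lastI rev_rcons.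
have b0E' : rcons (rev b0) x = s ++ rcons (rev s2) y ++ rev (belast x s).
  by rewrite /b0 !rev_cat revK -catA !rcons_cat cat_rcons -rev_cons lastI rev_rcons.
have aE : rcons (rev s1) x = rev (belast x a) by rewrite belast_rcons rev_cons.
have bE' : rcons (rev b0) x = rev (belast x (rcons b0 x)).
  by rewrite belast_rcons rev_cons.
(* The commutator: both loops, then both loops reversed in the same order. *)
pose full := a ++ rcons b0 x ++ rcons (rev s1) x ++ rcons (rev b0) x.
have Xrev u t : path X u t -> path X (last u t) (rev (belast u t)).
  by move=> Xt; rewrite rev_path; apply: sub_path Xt => v w; rewrite symX.
have W1 : path X x a := X1.
have W2 : path X y (rcons s2 y) := X2.
have Xb : path X x (rcons b0 x).
  by rewrite b0E !cat_path Xs -/y W2 last_rcons /=; apply: Xrev.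
have Xfull : path X x full.
  have := Xrev _ _ W1; have := Xrev _ _ Xb; rewrite !last_rcons -aE -bE'.
  by rewrite /full !cat_path W1 !last_rcons Xb => -> ->.
have lastfull : last x full = x by rewrite /full !last_cat !last_rcons.
have sf : 0 < size full <= g.
  rewrite /full /a /b0 !(size_cat, size_rcons, size_rev).
  by move: sg; clear; lia.
have n1 : s1 != [::] by case: (s1) l1.
have n2 : s2 != [::] by case: (s2) l2.
have nb0 : b0 != [::] by rewrite /b0; case: (s) => //; case: (s2) n2.
have d10 z : z \in s1 -> z \notin b0.
  move=> z1; rewrite !mem_cat mem_rev !negb_or.
  have -> : z \notin s by apply: contra d1s => zs; apply/hasP; exists z.
  by rewrite andbT; apply: contra d12 => zs; apply/hasP; exists z.
have nrev (t : seq T) : t != [::] -> rev t != [::].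
  by rewrite -!size_eq0 size_rev.
have d2 z : z \in s2 -> z \notin x :: s.
  move=> z2; rewrite inE negb_or (contraNneq _ x2) => [|<- //].
  by apply: contra ds2 => zs; apply/hasP; exists z.
have nbb : nonbacktracking (x :: rcons b0 x).
  rewrite /b0; case/lastP Es: s => [|s' v].
    rewrite cats0; apply: nonbacktracking_closed l2.
    by move: uc2; rewrite /y Es.
  have ev : y = v by rewrite /y Es last_rcons.
  rewrite ev in uc2; rewrite Es in ucs.
  have d2' z : z \in s2 -> z \notin x :: s'.
    by move=> /d2; rewrite Es -rcons_cons mem_rcons inE; case/norP.
  (* On entering and on leaving the second cycle at [v], one neighbour of [v] in the walk lies on
     [s2] and the other on [x :: s'], which are disjoint. *)
  rewrite rev_rcons !rcons_cat cat_rcons -cat_cons.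
  apply: nonbacktracking_cat; first exact: nonbacktracking_uniq.
  - rewrite rcons_cons -cat_rcons; apply: nonbacktracking_closed_cat.
    + exact: nonbacktracking_closed.
    + by apply: nonbacktracking_uniq; rewrite -rev_cons -rev_rcons rev_uniq.
    + apply: contraNneq (d2' _ (last_mem v n2)) => ->.
      by rewrite -mem_rev rev_cons; case: (rev s') => [|q r]; apply: mem_head.
  - apply: contraTneq (mem_last x s') => /= ->.
    by apply: d2'; case: (s2) n2 => //= q r _; apply: mem_head.
have nbfull : nonbacktracking (x :: full).
  have nb1 : nonbacktracking (x :: rcons s1 x) by apply: nonbacktracking_closed.
  have nbr (t : seq T) : nonbacktracking (x :: rcons t x) ->
      nonbacktracking (x :: rcons (rev t) x).
    by rewrite -nonbacktracking_rev rev_cons rev_rcons.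
  (* At each of the three seams at [x], one neighbour lies on [s1] and the other on [b0], which are
     disjoint by [d10]. *)
  apply: nonbacktracking_closed_cat => //; last first.
    have := d10 _ (last_mem x n1); apply: contraNneq => ->.
    exact: head_rcons_mem.
  apply: nonbacktracking_closed_cat => //; last first.
    have := last_mem x nb0; apply: contraTneq => ->; apply: d10.
    by rewrite -mem_rev; apply/head_rcons_mem/nrev.
  apply: nonbacktracking_closed_cat; try exact: nbr.
  have := last_mem x (nrev _ n1).
  rewrite mem_rev => /d10; apply: contraNneq => ->.
  by rewrite -mem_rev; apply/head_mem/nrev.
have permfull : hole_perm x full = 1%g.
  rewrite /full !hole_perm_cat !last_rcons aE bE'.
  have := hole_perm_rev x a; rewrite last_rcons => ->.
  have := hole_perm_rev x (rcons b0 x); rewrite last_rcons => ->.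
  suff com : commute (hole_perm x a) (hole_perm x (rcons b0 x)).
    by rewrite -invMg com -mulgA mulVg.
  apply: (@perm_onC _ [set z in s1] [set z in s2]).
  - exact: hole_perm_closed_on.
  (* The second loop acts as a conjugate, by the path permutation [Q], of a permutation supported on
     [s2]. As [Q] fixes [s2] pointwise, the conjugate is supported on [s2] too. *)
  - apply/subsetP => z; rewrite !inE; apply: contraR => z2.
    rewrite b0E !hole_perm_cat last_rcons hole_perm_rev !permM.
    set Q := hole_perm x s.
    have Qz2 : (Q^-1)%g z \notin s2.
      apply: contra z2 => Qz2; rewrite -(permKV Q z).
      by rewrite [Q _]hole_perm_out //; apply: d2.
    have /subsetP D2 := hole_perm_closed_on y s2.
    have /eqP -> : hole_perm y (rcons s2 y) ((Q^-1)%g z) == (Q^-1)%g z.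
      by apply: contraR Qz2 => /D2; rewrite inE.
    by rewrite permKV.
  - apply/pred0P => z; rewrite /= !inE; apply/negbTE/negP => /andP [z1 z2].
    by case/hasP: d12; exists z.
have [C [gC iC]] := closed_walk_girth_cycle irrX center_u0 girth_g
  Xfull lastfull sf nbfull permfull.
exists C; split=> //; rewrite {}iC.
have efull : eset (path_graph x full) =
    eset (cycle_graph (x :: s1)) :|: eset (cycle_graph (y :: s2))
      :|: eset (path_graph x s).
  have e1 := path_eset_rev x a; have e2 := path_eset_rev x (rcons b0 x).
  rewrite last_rcons -aE in e1; rewrite last_rcons -bE' in e2.
  rewrite /full !path_eset_cat !last_rcons e1 e2.
  rewrite b0E !path_eset_cat last_rcons path_eset_rev -/y !path_eset_closed //.
  by apply/setP => e; rewrite !in_setU; do 3!case: (e \in _).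
have vfull : [set z in full] = [set z in x :: s1] :|: [set z in y :: s2]
      :|: [set z in x :: s].
  apply/setP => z; rewrite /full /a /b0.
  rewrite !inE !(mem_cat, mem_rcons, mem_rev, inE).
  have [->|_] /= := eqVneq z y; last by do 4!case: (_ \in _) || case: (z == x).
  by move: ys; rewrite inE; do 4!case: (_ \in _) || case: (y == x).
have sub12 : [set z in x :: s1] :&: [set z in y :: s2] \subset [set x].
  apply/subsetP => z; rewrite !inE => /andP [/orP [//|z1] /orP [/eqP zy|z2]].
    by rewrite zy (negPf y1) in z1.
  by case/hasP: d12; exists z.
have sub1P : [set z in x :: s1] :&: [set z in x :: s] \subset [set x].
  apply/subsetP => z; rewrite !inE => /andP [/orP [//|z1] /orP [//|zs]].
  by case/hasP: d1s; exists z.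
have sub2P : [set z in y :: s2] :&: [set z in x :: s] \subset [set y].
  apply/subsetP => z; rewrite !inE => /andP [/orP [//|z2]].
  by move: (d2 _ z2); rewrite inE => /negPf ->.
have si1 : simple (cycle_graph (x :: s1)) by apply: simple_cycle_graph.
have si2 : simple (cycle_graph (y :: s2)) by apply: simple_cycle_graph.
have siP := simple_path_graph ucs.
exists (cycle_graph (x :: s1)), (cycle_graph (y :: s2)), (path_graph x s).
split=> //.
- by split; split=> //; rewrite ?efull /= ?vfull; apply/subsetP => z;
    rewrite !in_setU => ->; rewrite ?orbT.
- by split; [exists (x :: s1)|exists (y :: s2)].
- split=> //; first exact: (disjoint_eset si1 si2 sub12).
    exact: (disjoint_eset si1 siP sub1P).
  exact: (disjoint_eset si2 siP sub2P).
(* An empty [s] gives two cycles sharing exactly [x]; otherwise [y] differs from [x] and the cycles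
   are disjoint. *)
have [Es|sn] := eqVneq s [::].
  right; exists x; split; last by rewrite Es.
  apply/eqP; rewrite eqEsubset sub12 sub1set !inE eqxx /=.
  by rewrite /y Es eqxx.
left; exists x, y.
have yx : y != x by apply: contraNneq xs => <-; rewrite /y last_mem.
split; rewrite ?inE ?eqxx //; last 2 first.
- by exists s.
- apply/pred0P => z; apply/negbTE/negP => /= /andP [].
  rewrite !inE => /andP [/norP [zx zy] zP].
  rewrite (negPf zx) (negPf zy) /= in zP * => /orP [z1|/d2].
    by case/hasP: d1s; exists z.
  by rewrite inE zP orbT.
apply/pred0P => z; apply/negbTE/negP => /= /andP [z1 z2].
have : z \in [set x] by apply: (subsetP sub12); rewrite inE z1.
rewrite inE => /eqP zx; move: z2; rewrite zx !inE eq_sym (negPf yx) /=.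
by rewrite (negPf x2).
Qed.

End ClosedWalks.

(** * Sums over ranges and changes of a predicate *)

Lemma leq_term_sum (f : nat -> nat) m n i :
  m <= i < n -> f i <= \sum_(m <= j < n) f j.
Proof.
case/andP=> mi ni; rewrite (@big_cat_nat _ _ _ i) ?(ltnW ni) //=.
by rewrite [X in _ + X]big_ltn // addnCA leq_addr.
Qed.

Lemma sum_nat_shift (f : nat -> nat) L a : (forall i, f (i + L) = f i) ->
  \sum_(0 <= i < L) f (a + i) = \sum_(0 <= i < L) f i.
Proof.
move=> fL; elim: a => [//|a IH]; rewrite -[RHS]IH.
case: L fL IH => [|L] fL _; first by rewrite !big_geq.
rewrite big_nat_recr // [RHS]big_nat_recl //= addnC; congr (_ + _).
  by rewrite addSnnS fL addn0.
by apply: eq_big_nat => i _; rewrite addSnnS.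
Qed.

Lemma exists_change (P : pred nat) m n : m <= n -> P m -> ~~ P n ->
  exists2 a, m <= a < n & P a && ~~ P a.+1.
Proof.
move=> mn Pm; elim: n mn => [|n IH].
  by rewrite leqn0 => /eqP <-; rewrite Pm.
rewrite leq_eqVlt => /orP [/eqP <-|mn nP]; first by rewrite Pm.
have [Pn|Pn] := boolP (P n); first by exists n; rewrite ?Pn // ltnSn andbT.
case: (IH mn Pn) => a /andP [ma an] Pa.
by exists a => //; rewrite ma ltnW.
Qed.

Lemma leq_sum_unique p (P : pred 'I_p) :
  (forall i j, P i -> P j -> i = j) -> \sum_(i < p) P i <= 1.
Proof.
move=> uniqP; have [i Pi|P0] := pickP P; last first.
  by rewrite big1 // => i _; rewrite P0.
rewrite (bigD1 i) //= Pi big1 // => j; apply: contraNeq.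
by rewrite eqb0 negbK => Pj; rewrite (uniqP j i).
Qed.

(** * Cycles of [FS] as periodic walks of the hole *)

Section PeriodicWalk.

Variables (n : nat) (T : finType) (X : rel T).
Hypotheses (symX : symmetric X) (irrX : irreflexive X).

Local Notation conf := (bij T 'I_n).

(** The cycle is unrolled over all natural numbers, so that any index can serve as the start;
    distinct residues modulo [L] give distinct configurations. *)
Definition periodic_walk (L : nat) (w : nat -> conf) (h : nat -> T) : Prop :=
  [/\ 2 < L /\ forall i, center (val (w i) (h i)),
      forall i, X (h i) (h i.+1),
      forall i z, val (w i.+1) z = val (w i) (tperm (h i) (h i.+1) z),
      forall i, w (i + L) = w i
    & forall i j, w i = w j -> i = j %[mod L]].

Lemma periodic_walk_shift L w h a : periodic_walk L w h ->
  periodic_walk L (fun i => w (a + i)) (fun i => h (a + i)).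
Proof.
case=> [[L2 hc] hX hw wL wI]; split=> [|i|i z|i|i j].
- by split=> // i.
- by rewrite addnS.
- by rewrite addnS.
- by rewrite addnA.
- by move/wI/eqP; rewrite eqn_modDl => /eqP.
Qed.

Lemma periodic_hole L w h i : periodic_walk L w h -> h (i + L) = h i.
Proof.
case=> [[_ hc] _ _ wL _]; apply: (@hole_inj _ _ (w i)) (hc i).
by rewrite -wL.
Qed.

Lemma periodic_hole_mul L w h m i : periodic_walk L w h -> h (i + m * L) = h i.
Proof.
move=> pw; elim: m => [|m IH]; first by rewrite addn0.
by rewrite mulSn addnC -addnA (addnC L) (periodic_hole _ pw) addnC.
Qed.

Lemma periodic_hole_mod L w h i : periodic_walk L w h -> h (i %% L) = h i.
Proof.
by move=> pw; rewrite [in RHS](divn_eq i L) addnC (periodic_hole_mul _ _ pw).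
Qed.

Lemma periodic_nonbacktracking L w h i : periodic_walk L w h -> h i != h i.+2.
Proof.
case=> [[L2 hc] hX hw wL wI]; apply/eqP => e.
have /wI/eqP : w i = w i.+2.
  by apply: conf_eq => z; rewrite !hw -e [tperm _ (h i)]tpermC tpermK.
by rewrite -addn2 -{1}[i]addn0 eqn_modDl mod0n modn_small.
Qed.

(** * Edges crossed only once *)

Section Girth.

Variable k : nat.
Hypothesis girthX : forall c, 2 < size c -> uniq c -> cycle X c -> k <= size c.

(** Between the two visits the hole makes a closed nonbacktracking walk in [X], which contains a
    cycle of [X]. *)
Lemma hole_return L w h i j :
  periodic_walk L w h -> i < j -> h i = h j -> k <= j - i.
Proof.
move=> pw ij hij; have [_ hX _ _ _] := pw.
have [||||a [m [am m2 um cm]]] :=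
  @nonbacktracking_closed_cycle _ X (fun a => h (i + a)) (j - i) irrX.
- by rewrite subn_gt0.
- by rewrite addn0 subnKC // ltnW.
- by move=> a _; rewrite addnS.
- by move=> a _; rewrite !addnS; apply: periodic_nonbacktracking pw.
- have := girthX _ um cm; rewrite size_mkseq => /(_ m2); lia.
Qed.

(* Follow the token that crosses the edge. Its closed walk has at least [k]
   moves, and between two consecutive moves the hole walks from one side of the
   token to the other, which closes up to a closed walk of length at least [k]. *)
Lemma single_crossing_bound L w h : periodic_walk L w h ->
    (forall i, 0 < i < L -> [set h i; h i.+1] != [set h 0; h 1]) ->
  k * k.-1 <= L.
Proof.
move=> pw once; have [[L2 hc] hX hw wL wI] := pw.
have hL i := periodic_hole i pw.
have h01 : h 0 != h 1 by apply: contraTneq (hX 0) => <-; rewrite irrX.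
(* [pos i] is the position at time [i] of the token that stands at [h 1] at time 0. *)
pose pos := fix pos i := if i is i'.+1 then tperm (h i') (h i) (pos i') else h 1.
have posP i : val (w i) (pos i) = val (w 0) (h 1).
  by elim: i => // i IH; rewrite hw /= tpermK.
have posL : pos L = h 1.
  by apply: (@conf_inj _ _ (w 0)); rewrite -(posP L) -[L in RHS]add0n wL.
have pos_hole i : pos i != h i.
  apply: contraNneq h01 => e; apply/eqP/(@hole_inj _ _ (w 0)) => //.
  by rewrite -(posP i) e.
(* [M i] says that the token moves at step [i], and [N t] below counts its moves before time [t]. *)
pose M i := pos i == h i.+1.
have pos_move i : M i -> pos i.+1 = h i by move=> /eqP /= ->; rewrite tpermR.
have pos_stay i : ~~ M i -> pos i.+1 = pos i.
  by move=> Mi; rewrite /= tpermD // eq_sym // pos_hole.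
pose N t := \sum_(0 <= i < t) M i.
have NS t : N t.+1 = N t + M t by rewrite /N big_nat_recr.
have M0 : M 0 by apply/eqP.
have ML : M L by rewrite /M posL -[L.+1]add1n hL.
(* Here [l] is the time of the token's last move up to [t], and [m] counts the gaps between its
   moves so far. A gap of [d] steps brings the hole back to its earlier position after [d + 1]
   steps, so [d] is at least [k.-1]. *)
have gap t : exists l m, [/\ l <= t, pos t.+1 = h l, N t.+1 = m.+1
                           & m * k.-1 <= l].
  elim: t => [|t [l [m [lt post Nt ml]]]].
    by exists 0, 0; split=> //; [apply: pos_move|rewrite NS M0 /N big_geq].
  have [Mt|Mt] := boolP (M t.+1).
    exists t.+1, m.+1; split=> //; first exact: pos_move.
      by rewrite NS Nt Mt addn1.
    have := @hole_return L w h l t.+2 pw; rewrite -post (eqP Mt) => /(_ _ erefl).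
    by rewrite mulSn => kl; have {}kl := kl ltac:(lia); lia.
  exists l, m; split=> //; [exact: leqW|by rewrite pos_stay|].
  by rewrite NS Nt (negPf Mt) addn0.
(* After step 0 the token avoids the edge between [h 0] and [h 1] until time [L]. The walk [s]
   starts after that first move, hence [(size s).+1] moves in all. *)
pose X' := [rel u v | X u v && ([set u; v] != [set h 0; h 1])].
have walk t : t < L -> exists s, [/\ path X' (h 0) s, last (h 0) s = pos t.+1
                                   & (size s).+1 = N t.+1].
  elim: t => [|t IH] tL.
    by exists [::]; split=> //; [rewrite pos_move|rewrite NS M0 /N big_geq].
  have [s [Xs ls Ns]] := IH (ltnW tL).
  have [Mt|Mt] := boolP (M t.+1); last first.
    by exists s; rewrite NS (negPf Mt) addn0 pos_stay.
  exists (rcons s (h t.+1)); split.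
  - rewrite rcons_path Xs ls (eqP Mt) /= symX hX setUC once //.
  - by rewrite last_rcons pos_move.
  - by rewrite size_rcons NS Mt addn1 Ns.
have [s [Xs ls Ns]] := walk L.-1 ltac:(lia).
rewrite prednK in ls Ns; last by lia.
rewrite posL in ls; case: (shortenP Xs) ls => p Xp up sub lp.
have Xp' : path X (h 0) p by apply: sub_path Xp => u v /andP [].
(* Shortened and closed by the edge between [h 1] and [h 0], the token's walk is a cycle of [X]; it
   has at least three vertices because it avoids that edge. *)
have kN : k <= N L.
  rewrite -Ns; apply: leq_trans (_ : size (h 0 :: p) <= _); last first.
    by rewrite /= ltnS; apply: uniq_leq_size sub; case/andP: up.
  apply: girthX => //; last by rewrite /= rcons_path Xp' lp symX hX.
  case: p Xp lp {up sub Xp'} => [|u [|v p]] //=.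
    by move=> _ /eqP; rewrite (negPf h01).
  by move=> /andP [/andP [_ ne] _] uh; rewrite uh eqxx in ne.
(* The token moves again at time [L], repeating step 0, so [N L] whole gaps fit into [L] steps. *)
have [l [m [lL _ Nm ml]]] := gap L.
have {}Nm : m = N L by move: Nm; rewrite NS ML addn1 => -[].
apply: leq_trans lL; apply: leq_trans ml.
by rewrite leq_mul2r Nm kN orbT.
Qed.

End Girth.

(** * Crossings of the boundary of a vertex set *)

Definition crosses (h : nat -> T) (S : {set T}) (i : nat) : bool :=
  (h i \in S) != (h i.+1 \in S).

Lemma crosses_between (h : nat -> T) (S : {set T}) i j :
  i <= j -> (h i \in S) != (h j \in S) ->
  0 < \sum_(i <= a < j) crosses h S a.
Proof.
move=> ij ne.
have [a aij ca] : exists2 a, i <= a < j & crosses h S a.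
  pose P := [pred a | (h a \in S) == (h i \in S)].
  have [|//||a aij /andP [/eqP e1 e2]] := @exists_change P i j.
  - by [].
  - by rewrite /= eqxx.
  - by rewrite /= eq_sym.
  exists a => //; rewrite /crosses /P /= in e1 e2 *.
  by rewrite e1 eq_sym.
by apply: leq_trans (leq_term_sum (fun a => crosses h S a : nat) aij); rewrite ca.
Qed.

(** The opposite of the single-crossing case: within one period each step's edge is crossed at some
    other time, in either direction. *)
Definition recrossing L (h : nat -> T) : Prop :=
  forall a, exists2 i, 0 < i < L &
    [set h (a + i); h (a + i).+1] = [set h a; h a.+1].

Lemma recrossing_shift L h a :
  recrossing L h -> recrossing L (fun i => h (a + i)).
Proof.
move=> rc b; case: (rc (a + b)) => i iL e; exists i => //.
by rewrite !addnS !addnA.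
Qed.

(* A boundary crossed only twice is crossed twice along one edge, so the token
   on that edge returns and the excursion of the hole on the far side restores
   the configuration. *)
Lemma boundary_crossings_from L w h (S : {set T}) :
    periodic_walk L w h -> recrossing L h -> h 0 \in S -> h 1 \notin S ->
  4 <= \sum_(0 <= a < L) crosses h S a.
Proof.
move=> pw rc h0 h1; have [[L2 hc] hX hw wL wI] := pw.
have hL : h L = h 0 by rewrite -[L]add0n (periodic_hole _ pw).
have [b /andP [b1 bL] /andP [/= hb]] :
    exists2 b, 1 <= b < L & (h b \notin S) && (h b.+1 \in S).
  have [|||b bL /andP [hb hb1]] := @exists_change [pred i | h i \notin S] 1 L.
  - exact: ltnW (ltnW L2).
  - exact: h1.
  - by rewrite /= negbK hL.
  by exists b => //; rewrite /= negbK in hb1; apply/andP.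
move=> hb1.
(* The hole leaves [S] at step 0 and enters it at step [b]. If it is outside again at a later time
   [c], there are four crossings, separated by the times 1, [b.+1] and [c]. *)
have [/existsP [[c cL] /= /andP [bc hcS]]|stay] :=
    boolP [exists c : 'I_L, (b < c) && (h c \notin S)].
  rewrite (@big_cat_nat _ _ _ 1) //=; last exact: ltnW (ltnW L2).
  rewrite (@big_cat_nat _ _ _ b.+1 1) //=.
  rewrite (@big_cat_nat _ _ _ c b.+1) //=; last exact: ltnW cL.
  have c1 : 0 < \sum_(0 <= a < 1) crosses h S a.
    by apply: crosses_between; rewrite // h0 (negPf h1).
  have c2 : 0 < \sum_(1 <= a < b.+1) crosses h S a.
    by apply: crosses_between; rewrite ?hb1 ?(negPf h1) // ltnW.
  have c3 : 0 < \sum_(b.+1 <= a < c) crosses h S a.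
    by apply: crosses_between; rewrite ?hb1 ?(negPf hcS).
  have c4 : 0 < \sum_(c <= a < L) crosses h S a.
    by apply: crosses_between; rewrite ?hL ?h0 ?(negPf hcS) // ltnW.
  exact: (leq_add c1 (leq_add c2 (leq_add c3 c4))).
have inS c : b < c -> c <= L -> h c \in S.
  move=> bc; rewrite leq_eqVlt => /orP [/eqP ->|cL]; first by rewrite hL.
  move: stay; rewrite negb_exists => /forallP /(_ (Ordinal cL)) /=.
  by rewrite bc negbK.
(* Likewise, a visit to [S] at a time [c] between 1 and [b] gives four crossings. *)
have [outS|] := boolP [forall c : 'I_b, (0 < c) ==> (h c \notin S)]; last first.
  rewrite negb_forall => /existsP [[c cb] /=].
  rewrite negb_imply negbK => /andP [c0 hcS].
  have c1 : 0 < \sum_(0 <= a < 1) crosses h S a.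
    by apply: crosses_between; rewrite // h0 (negPf h1).
  have c2 : 0 < \sum_(1 <= a < c) crosses h S a.
    by apply: crosses_between; rewrite ?hcS ?(negPf h1).
  have c3 : 0 < \sum_(c <= a < b) crosses h S a.
    by apply: crosses_between; rewrite ?hcS ?(negPf hb) // ltnW.
  have c4 : 0 < \sum_(b <= a < L) crosses h S a.
    by apply: crosses_between; rewrite ?hL ?h0 ?(negPf hb) // ltnW.
  rewrite (@big_cat_nat _ _ _ 1) //=; last exact: ltnW (ltnW L2).
  rewrite (@big_cat_nat _ _ _ c 1) //=; last exact: ltnW (ltn_trans cb bL).
  rewrite (@big_cat_nat _ _ _ b c) //=; [|exact: ltnW|exact: ltnW].
  exact: (leq_add c1 (leq_add c2 (leq_add c3 c4))).
have {}outS c : 0 < c -> c <= b -> h c \notin S.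
  move=> c0; rewrite leq_eqVlt => /orP [/eqP -> //|cb].
  by have /implyP := forallP outS (Ordinal cb); apply.
(* Only steps 0 and [b] cross the boundary now, so the second crossing of the edge of step 0 is step
   [b], in the opposite direction. *)
have [hb_1 hb_0] : h b = h 1 /\ h b.+1 = h 0.
  have [i /andP [i0 iL] /set2_eq] := rc 0; rewrite !add0n.
  have [ib|bi] := leqP i b.
    case=> [[e _]|[e1 e0]]; first by have := outS i i0 ib; rewrite e h0.
    suff <- : i = b by [].
    apply/eqP; rewrite eqn_leq ib leqNgt; apply/negP => ib'.
    by have := outS i.+1 isT ib'; rewrite e0 h0.
  have := inS i bi (ltnW iL); have := inS i.+1 (leqW bi) iL.
  by move=> i1S iS [[_ e]|[e _]]; [rewrite -e i1S in h1|rewrite -e iS in h1].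
have keep_out j z : z \in S -> j <= b -> 0 < j -> val (w j) z = val (w 1) z.
  move=> zS; elim: j => [//|[//|j] IH] jb _; rewrite hw tpermD ?IH //.
  - exact: ltnW.
  - by apply: contraNneq (outS j.+1 isT (ltnW jb)) => ->.
  - by apply: contraNneq (outS j.+2 isT jb) => ->.
have keep_in j z : z \notin S -> b < j -> j <= L -> val (w j) z = val (w b.+1) z.
  move=> zS; elim: j => [//|j IH]; rewrite ltnS leq_eqVlt.
  case/orP => [/eqP -> //|bj] jL; rewrite hw tpermD ?IH // 1?ltnW //.
  - by apply: contraNneq zS => <-; apply: inS => //; apply: ltnW.
  - by apply: contraNneq zS => <-; apply: inS => //; apply: leqW.
(* Labels on [S] rest while the hole is outside. Labels off [S] rest from time [b.+1] to [L], and
   steps 0 and [b] change them only at [h 1], where the hole is at times 1 and [b]. Equality forces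
   [b = 1], and then the hole backtracks. *)
have /wI/eqP : w b = w 1.
  apply: conf_eq => z; have [zS|zS] := boolP (z \in S); first exact: keep_out.
  have [->|zh] := eqVneq z (h 1).
    by apply: center_inj; [rewrite -hb_1; apply: hc|apply: hc].
  have zh0 : h 0 != z by apply: contraNneq zS => <-.
  rewrite [RHS]hw tpermD 1?[h 1 == z]eq_sym //.
  rewrite -(wL 0) add0n (keep_in L) // hw tpermD //; first by rewrite hb_1 eq_sym.
  by rewrite hb_0.
rewrite !modn_small ?(ltnW L2) // => /eqP b_1.
by have := periodic_nonbacktracking 0 pw; rewrite -hb_0 b_1 eqxx.
Qed.

Lemma boundary_crossings L w h (S : {set T}) i j :
    periodic_walk L w h -> recrossing L h -> h i \in S -> h j \notin S ->
  4 <= \sum_(0 <= a < L) crosses h S a.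
Proof.
move=> pw rc hi hj; have [[L2 _] _ _ _ _] := pw.
(* [j + i * L] is a time equivalent to [j] and not before [i], so between them some step [a] leaves
   [S]; the count is restarted there. *)
have [|||a _ /andP [/= ha ha1]] :=
    @exists_change [pred a | h a \in S] i (j + i * L).
- by apply: leq_trans (leq_addl _ _); rewrite leq_pmulr // ltnW // ltnW.
- by [].
- by rewrite /= (periodic_hole_mul _ _ pw).
have cL b : crosses h S (b + L) = crosses h S b.
  by rewrite /crosses -addSn !(periodic_hole _ pw).
rewrite -(@sum_nat_shift (fun b => crosses h S b) L a); last by move=> b; rewrite cL.
have -> : \sum_(0 <= b < L) crosses h S (a + b) =
          \sum_(0 <= b < L) crosses (fun b => h (a + b)) S b.
  by apply: eq_bigr => b _; rewrite /crosses addnS.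
apply: boundary_crossings_from (periodic_walk_shift a pw) _ _ _.
- exact: recrossing_shift.
- by rewrite addn0.
- by rewrite addn1.
Qed.

(** * Counting visits to edges *)

Definition visited (h : nat -> T) (e : {set T}) : Prop :=
  exists a, e = [set h a; h a.+1].

Lemma visited_cycle h (c : seq T) :
    2 < size c -> {in eset (cycle_graph c), forall e, visited h e} ->
  exists a, h a \in c.
Proof.
case: c => [//|x c] _ vis.
have /vis [a /set2_eq [] [e _]] :
    [set x; next (x :: c) x] \in eset (cycle_graph (x :: c)).
  exact/imset_f/mem_head.
- by exists a; rewrite -e mem_head.
- by exists a.+1; rewrite -e mem_head.
Qed.

Lemma visited_twice L w h e : periodic_walk L w h -> recrossing L h ->
  visited h e -> 2 <= \sum_(0 <= i < L) ([set h i; h i.+1] == e).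
Proof.
move=> pw rc [a ->].
rewrite -(@sum_nat_shift (fun i => [set h i; h i.+1] == [set h a; h a.+1]) L a).
  case: (rc a) => i /andP [i0 iL] e'.
  rewrite big_ltn ?(leq_trans _ iL) // addn0 eqxx.
  apply: (@leq_add 1 1) => //.
  apply: leq_trans (leq_term_sum _ (_ : 1 <= i < L)); last by rewrite i0.
  by rewrite /= e' eqxx.
by move=> i; rewrite -addSn !(periodic_hole _ pw).
Qed.

Lemma visited_edges_twice L w h (E : {set {set T}}) :
    periodic_walk L w h -> recrossing L h -> {in E, forall e, visited h e} ->
  2 * #|E| <= \sum_(0 <= i < L) ([set h i; h i.+1] \in E).
Proof.
move=> pw rc vE.
have -> : \sum_(0 <= i < L) ([set h i; h i.+1] \in E) =
          \sum_(e in E) \sum_(0 <= i < L) ([set h i; h i.+1] == e).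
  rewrite exchange_big /=; apply: eq_bigr => i _.
  have [hE|hE] := boolP (_ \in E); last first.
    by rewrite big1 // => e eE; case: eqP => // he; rewrite he eE in hE.
  rewrite (bigD1 [set h i; h i.+1]) //= eqxx big1 // => e /andP [_].
  by rewrite eq_sym => /negPf ->.
rewrite mulnC -sum_nat_const; apply: leq_sum => e /vE.
exact: (visited_twice pw rc).
Qed.

(** * Distance balls in [X] and the length bound *)

Definition ball (S : {set T}) (j : nat) : {set T} :=
  iter j (fun B : {set T} => [set v | (v \in B) || [exists u in B, X u v]]) S.

Lemma sub_ball (S : {set T}) i j : i <= j -> ball S i \subset ball S j.
Proof.
elim: j => [|j IH]; first by rewrite leqn0 => /eqP ->.
rewrite leq_eqVlt => /orP [/eqP -> //|/IH sub]; apply: subset_trans sub _.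
by apply/subsetP => v vB; rewrite inE vB.
Qed.

Lemma ball_step (S : {set T}) j u v : X u v -> u \in ball S j -> v \in ball S j.+1.
Proof.
by move=> Xuv uB; rewrite inE; apply/orP; right; apply/existsP; exists u; rewrite uB.
Qed.

Lemma ball_path (S : {set T}) j v : v \in ball S j ->
  exists x s, [/\ x \in S, path X x s, last x s = v & size s <= j].
Proof.
elim: j v => [|j IH] v; first by exists v, [::].
rewrite inE => /orP [/IH [x [s [xS Xs ls sj]]]|/existsP [u /andP [uB Xuv]]].
  by exists x, s; split=> //; apply: leqW.
have [x [s [xS Xs ls sj]]] := IH u uB; exists x, (rcons s v).
by rewrite rcons_path Xs ls last_rcons size_rcons.
Qed.

(** A step changes the distance to [S] by at most one, so it crosses the boundary of at most one
    ball. *)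
Lemma crosses_ball_unique L w h (S : {set T}) i j j' : periodic_walk L w h ->
  crosses h (ball S j) i -> crosses h (ball S j') i -> j = j'.
Proof.
move=> pw; wlog jj : j j' / j < j'.
  move=> wl cj cj'; case: (ltngtP j j') => // jj; first exact: wl.
  by apply/esym/wl.
have [_ hX _ _ _] := pw; rewrite /crosses => cj; apply: contraTeq => _.
have step u v : X u v -> u \in ball S j -> v \in ball S j'.
  by move=> Xuv uB; apply: (subsetP (sub_ball S jj)); apply: ball_step Xuv uB.
have mono u : u \in ball S j -> u \in ball S j'.
  by apply/subsetP/sub_ball/ltnW.
rewrite negbK; have [hi|hi] := boolP (h i \in ball S j).
  by rewrite (mono _ hi) (step _ _ (hX i) hi).
have hi1 : h i.+1 \in ball S j by rewrite (negPf hi) /= negbK in cj.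
have Xb : X (h i.+1) (h i) by rewrite symX.
by rewrite (mono _ hi1) (step _ _ Xb hi1).
Qed.

(** A step lies on the first cycle, lies on the second, or crosses one of the [p] ball boundaries
    between them, and these cases exclude each other. Every cycle edge is used at least twice and
    every boundary is crossed at least four times. *)
Lemma barbell_length_bound L w h c1 c2 p :
    periodic_walk L w h -> recrossing L h ->
    2 < size c1 -> uniq c1 -> {in eset (cycle_graph c1), forall e, visited h e} ->
    2 < size c2 -> uniq c2 -> {in eset (cycle_graph c2), forall e, visited h e} ->
    [disjoint eset (cycle_graph c1) & eset (cycle_graph c2)] ->
    (forall x s, x \in c1 -> path X x s -> last x s \in c2 -> p <= size s) ->
  2 * (size c1 + size c2 + 2 * p) <= L.
Proof.
move=> pw rc l1 u1 v1 l2 u2 v2 dis far.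
set E1 := eset _ in v1 dis; set E2 := eset _ in v2 dis.
pose S := [set x in c1]; pose cross i j := crosses h (ball S j) i.
have on_edge c i : 2 < size c -> uniq c ->
    [set h i; h i.+1] \in eset (cycle_graph c) -> h i \in c /\ h i.+1 \in c.
  move=> lc uc /(simple_cycle_graph lc uc) [_ /subsetP sub].
  by have := sub _ (set21 _ _); have := sub _ (set22 _ _); rewrite !inE.
have in1 j v : v \in c1 -> v \in ball S j.
  by move=> vc; apply: (subsetP (sub_ball S (leq0n j))); rewrite inE.
have out2 j v : j < p -> v \in c2 -> v \notin ball S j.
  move=> jp vc; apply/negP => /ball_path [x [s [xS Xs ls sj]]].
  rewrite inE in xS; have := far x s xS Xs; rewrite ls => /(_ vc) ps.
  by have := leq_trans jp (leq_trans ps sj); rewrite ltnn.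
(* A step inside [c1] stays in every ball and a step inside [c2] stays outside all [p] balls, so
   neither crosses a boundary. *)
have le1 i : ([set h i; h i.+1] \in E1) + ([set h i; h i.+1] \in E2)
    + \sum_(j < p) cross i j <= 1.
  have [e1|e1] := boolP (_ \in E1).
    rewrite (disjointFr dis e1) big1 // => j _.
    have [hi hi1] := on_edge c1 i l1 u1 e1.
    by rewrite /cross /crosses !in1.
  have [e2|e2] := boolP (_ \in E2).
    rewrite big1 // => j _; have [hi hi1] := on_edge c2 i l2 u2 e2.
    by rewrite /cross /crosses !(negPf (out2 _ _ _ _)).
  rewrite !add0n; apply: leq_sum_unique => j j' cj cj'; apply: val_inj.
  exact: crosses_ball_unique pw cj cj'.
have total : \sum_(0 <= i < L) (([set h i; h i.+1] \in E1)
    + ([set h i; h i.+1] \in E2) + \sum_(j < p) cross i j) <= L.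
  have eL : \sum_(0 <= i < L) 1 = L by rewrite sum_nat_const_nat subn0 muln1.
  by rewrite -[X in _ <= X]eL; apply: leq_sum => i _; apply: le1.
apply: leq_trans total; rewrite !big_split /= exchange_big /=.
have E1c : 2 * size c1 <= \sum_(0 <= i < L) ([set h i; h i.+1] \in E1).
  by rewrite -(card_cycle_graph l1 u1); apply: visited_edges_twice pw rc v1.
have E2c : 2 * size c2 <= \sum_(0 <= i < L) ([set h i; h i.+1] \in E2).
  by rewrite -(card_cycle_graph l2 u2); apply: visited_edges_twice pw rc v2.
have crossc : p * 4 <= \sum_(j < p) \sum_(0 <= i < L) cross i j.
  rewrite -{1}(card_ord p) -sum_nat_const; apply: leq_sum => j _.
  have [a ha] := visited_cycle l1 v1; have [b hb] := visited_cycle l2 v2.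
  exact: (boundary_crossings pw rc (in1 j _ ha) (out2 j _ (ltn_ord j) hb)).
apply: leq_trans (leq_add (leq_add E1c E2c) crossc).
have arith a b : 2 * (a + b + 2 * p) = 2 * a + 2 * b + p * 4 by clear; lia.
by rewrite arith.
Qed.

End PeriodicWalk.

(** * Cycles transported along an isomorphism, and cycles of [FS] as walks *)

Lemma pullback_cycle (T U : finType) (f : T -> U) (H : graph T) (c : seq U) :
    simple H -> {in vset H &, injective f} -> 2 < size c -> uniq c ->
    eset (cycle_graph c) \subset [set f @: (e : {set T}) | e in eset H] ->
  exists c', [/\ map f c' = c, uniq c', {subset c' <= vset H}
               & eset (cycle_graph c') \subset eset H].
Proof.
move=> sH injf lc uc sub.
have edge u : u \in c -> exists2 e : {set T}, e \in eset H & [set u; next c u] = f @: e.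
  by move=> uc'; apply/imsetP/(subsetP sub)/imset_f.
have [x0 _] : exists x : T, x \in vset H.
  case: c lc edge {uc sub} => [//|u c] _ /(_ u (mem_head _ _)) [e /sH [_ /subsetP eH] ue].
  have /imsetP [x /eH xH _] : u \in f @: e by rewrite -ue set21.
  by exists x.
(* [g] inverts [f] on the vertices of [c], choosing preimages in [vset H], where [f] is injective;
   [x0] is only the default of [odflt]. *)
pose g u := odflt x0 [pick v in vset H | f v == u].
have gP u : u \in c -> g u \in vset H /\ f (g u) = u.
  move=> /edge [e /sH [_ /subsetP eH] ue]; rewrite /g.
  case: pickP => [v /andP [vH /eqP] //|no].
  have /imsetP [x /eH xH ux] : u \in f @: e by rewrite -ue set21.
  by have := no x; rewrite xH ux eqxx.
have fgc : map f (map g c) = c.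
  by rewrite -map_comp -[RHS]map_id; apply/eq_in_map => u /gP [].
have ugc : uniq (map g c) by apply: (@map_uniq _ _ f); rewrite fgc.
exists (map g c); split=> //; first by move=> x /mapP [u /gP [gH _] ->].
rewrite cycle_eset // cycle_map; apply: cycle_from_next => // u uc' /=.
have [e eH ue] := edge u uc'; have [e2 /subsetP esub] := sH e eH.
have ge v : v \in c -> v \in f @: e -> g v \in e.
  move=> /gP [gH fg] /imsetP [x xe vx].
  have -> : g v = x by apply: injf; rewrite ?fg //; apply: esub.
  by [].
have nc : next c u \in c by rewrite mem_next.
suff -> : [set g u; g (next c u)] = e by [].
apply/eqP; rewrite eqEcard e2 subUset !sub1set.
rewrite !ge -?ue ?set21 ?set22 //= cards2.
have [un _] := next_neq2 lc uc uc'.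
suff -> : g u != g (next c u) by [].
apply: contraNneq un => gu.
have [_ fu] := gP u uc'; have [_ fn] := gP _ nc.
by rewrite -fn -gu fu.
Qed.

Lemma girth_cycle_walk (n : nat) (T : finType) (X : rel T) C :
    symmetric X -> irreflexive X -> cycle_subgraph C (graph_of (FS X (@star n))) ->
  exists L w h, [/\ periodic_walk X L w h, uniq (mkseq w L)
                  & C = cycle_graph (mkseq w L)].
Proof.
move=> symX irrX /(cycle_subgraph_inv (FS_sym X (n := n))) [c [-> lc uc Fc]].
have [s0 _] : exists s, s \in c by case: (c) lc => // s c' _; exists s; apply: mem_head.
pose L := size c; pose w i := nth s0 c (i %% L).
have L0 : 0 < L by apply: leq_trans lc.
have cE : mkseq w L = c.
  rewrite -[RHS](mkseq_nth s0); apply/eq_in_map => i.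
  by rewrite mem_iota => /= iL; rewrite /w modn_small.
have wL i : w (i + L) = w i by rewrite /w modnDr.
have wF i : FS X (@star n) (w i) (w i.+1).
  have jL : i %% L < L by rewrite ltn_mod.
  have wj : w i = w (i %% L) by rewrite /w modn_mod.
  have wj1 : w i.+1 = w (i %% L).+1 by rewrite /w -addn1 -[in RHS]addn1 modnDml.
  rewrite wj1 -(@next_mkseq _ w L) // ?cE //; last by rewrite -(wL 0).
  by rewrite wj; apply: next_cycle => //; rewrite -cE map_f // mem_iota.
(* The edge leaving [w i] exchanges the center label with another, which locates the hole. *)
have holes i : exists v, center (val (w i) v).
  case/existsP: (wF i) => a /existsP [b /and5P [_ /andP [_ /orP [ca|cb]] _ _ _]].
    by exists a.
  by exists b.
pose h i := xchoose (holes i).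
have hc i : center (val (w i) (h i)) := xchooseP (holes i).
have step i := FS_inv symX (wF i) (hc i) (hc i.+1).
exists L, w, h; rewrite cE; split=> //; split=> //.
- by move=> i; case: (step i).
- by move=> i; case: (step i).
- move=> i j /eqP; rewrite /w nth_uniq ?ltn_mod // => /eqP //.
Qed.

(** * Shortest cycles and shortest connecting paths *)

Lemma shortest_cycle (T : finType) (X : rel T) c :
    2 < size c -> uniq c -> cycle X c ->
  exists K, [/\ 2 < size K, uniq K, cycle X K
              & forall c', 2 < size c' -> uniq c' -> cycle X c' ->
                size K <= size c'].
Proof.
move=> lc uc Xc.
pose P m := (2 < m) && [exists t : m.-tuple T, uniq t && cycle X t].
have PI s : 2 < size s -> uniq s -> cycle X s -> P (size s).
  by move=> ls us Xs; rewrite /P ls; apply/existsP; exists (in_tuple s); apply/andP.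
case: (@ex_minnP P) => [|m /andP [m2 /existsP [t /andP [ut Xt]]] minm].
  by exists (size c); apply: PI.
exists t; rewrite size_tuple; split=> // s ls us Xs.
exact/minm/PI.
Qed.

Lemma shortest_path (T : finType) (X : rel T) (A B : {pred T}) x s :
    x \in A -> path X x s -> last x s \in B ->
  exists y t, [/\ y \in A, path X y t, last y t \in B
    & forall z u, z \in A -> path X z u -> last z u \in B -> size t <= size u].
Proof.
move=> xA Xs lB.
pose P m := [exists t : m.-tuple T, exists y : T,
  [&& y \in A, path X y t & last y t \in B]].
have PI y t : y \in A -> path X y t -> last y t \in B -> P (size t).
  move=> yA Xt tB; apply/existsP; exists (in_tuple t); apply/existsP; exists y.
  exact/and3P.
case: (@ex_minnP P) => [|m /existsP [t /existsP [y /and3P [yA Xt tB]]] minm].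
  by exists (size s); apply: PI lB.
exists y, t; rewrite size_tuple; split=> // z u zA Xu uB.
exact/minm/(PI z).
Qed.

(** A shortest path between the cycles repeats no vertex and meets each cycle only at its own end
    there. Rotating the cycles to start at these ends gives the form used for the commutator
    walk. *)
Lemma shortest_path_uniq (T : finType) (X : rel T) (c1 c2 : seq T) x s :
    x \in c1 -> path X x s -> last x s \in c2 ->
    (forall z u, z \in c1 -> path X z u -> last z u \in c2 ->
       size s <= size u) ->
    (forall y z, y \in c1 -> y \in c2 -> z \in c1 -> z \in c2 -> y = z) ->
    uniq c1 -> uniq c2 ->
  exists s1 s2 i j, [/\ rot i c1 = x :: s1, rot j c2 = last x s :: s2
                      & uniq (x :: s1 ++ s ++ s2)].
Proof.
move=> x1 Xs l2 mins one u1 u2.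
have [i s1 e1] := rot_to x1; have [j s2 e2] := rot_to l2.
exists s1, s2, i, j; split=> //.
have uc1 : uniq (x :: s1) by rewrite -e1 rot_uniq.
have uc2 : uniq (last x s :: s2) by rewrite -e2 rot_uniq.
have m1 z : z \in c1 = (z \in x :: s1) by rewrite -e1 mem_rot.
have m2 z : z \in c2 = (z \in last x s :: s2) by rewrite -e2 mem_rot.
have us : uniq (x :: s).
  have [p [Xp up sub lp]] : exists p, [/\ path X x p, uniq (x :: p),
      {subset p <= s} & last x p = last x s].
    by case: (shortenP Xs) => p Xp up sub; exists p.
  apply: (leq_size_uniq up) => [z|]; last by apply: mins Xp _; rewrite ?lp.
  by rewrite !inE => /orP [-> //|/sub ->]; rewrite orbT.
have ds1 z : z \in s -> z \notin c1.
  move=> zs; apply/negP => z1; case/splitPr: zs Xs l2 mins => p1 p2.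
  rewrite cat_path last_cat /= => /and3P [_ _ Xp2] l2 /(_ z p2 z1 Xp2 l2).
  by rewrite size_cat /= addnS ltnNge leq_addl.
(* A common vertex is itself a path of length zero between the cycles, so the shortest path is
   trivial. *)
have nil z : z \in c1 -> z \in c2 -> s = [::].
  by move=> z1 z2; have := mins z [::] z1 isT z2; case: (s).
have ds2 z : z \in x :: s -> z \in c2 -> z = last x s.
  rewrite inE => /orP [/eqP -> x2|zs z2]; first by rewrite (nil x x1 x2).
  move: Xs mins; case/splitPr: zs => p1 p2; rewrite -cat_rcons cat_path last_cat.
  rewrite last_rcons size_cat => /andP [Xp1 _] /(_ x _ x1 Xp1).
  rewrite last_rcons => /(_ z2); case: (p2) => //= v q.
  by rewrite addnS ltnNge leq_addr.
have x_s1 : x \notin s1 by case/andP: uc1.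
have l_s2 : last x s \notin s2 by case/andP: uc2.
have s1c z : z \in s1 -> z \in c1 by rewrite m1 inE => ->; rewrite orbT.
have s2c z : z \in s2 -> z \in c2 by rewrite m2 inE => ->; rewrite orbT.
have [xs us'] : x \notin s /\ uniq s by apply/andP.
have us1 : uniq s1 by case/andP: uc1.
have us2 : uniq s2 by case/andP: uc2.
rewrite /= !cat_uniq !mem_cat !has_cat !negb_or x_s1 xs us1 us' us2 !andbT /=.
apply/and3P; split.
- apply: contra l_s2 => x2; rewrite -(ds2 x) ?mem_head //; exact: s2c.
- apply/andP; split; apply/hasPn => z zs; first by apply: contra (ds1 z zs); apply: s1c.
  apply: contra x_s1 => z1; have z1c := s1c z z1; have z2c := s2c z zs.
  rewrite -(one z x) //; move: l2; rewrite (nil z z1c z2c) //.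
- apply/hasPn => z z2; apply: contra l_s2 => zs.
  by rewrite -(ds2 z) ?inE ?zs ?orbT //; apply: s2c.
Qed.

Theorem theorem4p15 (n : nat) (T : finType) (X : rel T)
  (cardT : #|T| = n) (symX : symmetric X) (irrX : irreflexive X) :
  (exists C : graph (bij T 'I_n),
     girth_cycle (graph_of (FS X (@star n))) C /\
     exists H : graph T, subgraph H (induced C) /\
       exists (U : finType) (B : graph U), is_barbell B /\ isomorphic H B) ->
  exists C : graph (bij T 'I_n),
    girth_cycle (graph_of (FS X (@star n))) C /\
    (is_cycle (induced C) \/ is_barbell (induced C)).
Proof.
case=> C [[cyC girthC] [H [[sH _ HC] [U [B [barB [f [injf _ eH]]]]]]]].
have [L [w [h [pw uw eC]]]] := girth_cycle_walk symX irrX cyC.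
have [[L2 hc] hX hw wL wI] := pw.
have gL : is_girth (graph_of (FS X (@star n))) L.
  by move: girthC; rewrite eC card_cycle_graph ?size_mkseq.
have wL0 : w L = w 0 by rewrite -(wL 0).
have vis e : e \in eset (induced C) -> visited h e.
  have hwalk : hole_walk X L w h by split=> [i _|i _|i z _].
  rewrite eC (induced_hole_walk irrX hwalk uw wL0).
  by rewrite /= inE => /mapP [a _ ->]; exists a.
(* The closed walk of the hole contains a cycle of [X], so a shortest cycle [K] exists. *)
have [c [lc uc Xc]] : exists c, [/\ 2 < size c, uniq c & cycle X c].
  have [||||i [m [_ m2 um cm]]] := @nonbacktracking_closed_cycle _ X h L irrX.
  - exact: leq_trans L2.
  - by rewrite -(periodic_hole 0 pw).
  - by [].
  - by move=> i _; apply: periodic_nonbacktracking pw.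
  - by exists (mkseq (fun j => h (i + j)) m); rewrite size_mkseq.
have [K [lK uK XK minK]] := shortest_cycle lc uc Xc.
(* Either some step [a] uses an edge that no other step of the period uses, or every edge of the
   walk is crossed at least twice. *)
have [/existsP [a /forallP once]|often] := boolP [exists a : 'I_L,
    [forall i : 'I_L, (0 < i) ==>
       ([set h (a + i); h (a + i).+1] != [set h a; h a.+1])]].
  have KL : size K * (size K).-1 <= L.
    apply: (single_crossing_bound symX irrX minK (periodic_walk_shift a pw)).
    move=> i /andP [i0 iL]; rewrite addn0 addn1 addnS.
    exact: (implyP (once (Ordinal iL))).
  have [D [gD iD]] := rotation_girth_cycle irrX (hc 0) gL lK uK XK KL.
  by exists D; split=> //; left.
have rc : recrossing L h.
  move=> a; have L0 : 0 < L by apply: leq_trans L2.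
  have aL : a %% L < L by rewrite ltn_mod.
  move: often; rewrite negb_exists => /forallP /(_ (Ordinal aL)).
  rewrite negb_forall => /existsP [i]; rewrite negb_imply negbK /= => /andP [i0 /eqP e].
  exists i; first by rewrite i0 /=.
  have hm b : h (a %% L + b) = h (a + b).
    by rewrite -(periodic_hole_mod _ pw) modnDml (periodic_hole_mod _ pw).
  by move: e; rewrite -!addnS !hm -[(a %% L).+1]addn1 hm addn1 (periodic_hole_mod _ pw).
have [C1 [C2 [P [[[_ _ E1B] [_ _ E2B] _] [cyC1 cyC2] _ _ shape]]]] := barB.
have [[d1 [l1 u1 eC1]] [d2 [l2 u2 eC2]]] := (cyC1, cyC2).
(* In both shapes of a barbell the two cycles have at most one common vertex. *)
have one u v : u \in d1 -> u \in d2 -> v \in d1 -> v \in d2 -> u = v.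
  move=> ud1 ud2 vd1 vd2; case: shape => [[x [y [dis _ _ _ _]]]|[x [inter _]]].
    have uC1 : u \in vset C1 by rewrite eC1 inE.
    have uC2 : u \in vset C2 by rewrite eC2 inE.
    by rewrite (disjointFr dis uC1) in uC2.
  have mem_x z : z \in d1 -> z \in d2 -> z = x.
    move=> z1 z2; apply/set1P; rewrite -inter eC1 eC2 !inE z1.
    exact: z2.
  by rewrite (mem_x u) // (mem_x v).
have [c1 [f1 uc1 s1 ec1]] : exists c', [/\ map f c' = d1, uniq c',
    {subset c' <= vset H} & eset (cycle_graph c') \subset eset H].
  by apply: pullback_cycle => //; rewrite eH -eC1.
have [c2 [f2 uc2 s2 ec2]] : exists c', [/\ map f c' = d2, uniq c',
    {subset c' <= vset H} & eset (cycle_graph c') \subset eset H].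
  by apply: pullback_cycle => //; rewrite eH -eC2.
have lc1 : 2 < size c1 by rewrite -(size_map f) f1.
have lc2 : 2 < size c2 by rewrite -(size_map f) f2.
have onec u v : u \in c1 -> u \in c2 -> v \in c1 -> v \in c2 -> u = v.
  move=> u1' u2' v1 v2; apply: injf; rewrite ?s1 //.
  by apply: one; rewrite -?f1 -?f2 map_f.
have visE c' : eset (cycle_graph c') \subset eset H ->
    {in eset (cycle_graph c'), forall e, visited h e}.
  by move=> /subset_trans /(_ HC) /subsetP sub e /sub; apply: vis.
have cycX c' : uniq c' -> eset (cycle_graph c') \subset eset H -> cycle X c'.
  move=> uc' sub; apply: cycle_from_next => // x xc'.
  have /(visE c' sub) [a] : [set x; next c' x] \in eset (cycle_graph c').
    exact: imset_f.
  by move=> /set2_eq [] [-> ->]; rewrite // symX.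
have dis : [disjoint eset (cycle_graph c1) & eset (cycle_graph c2)].
  have [z inter] : exists z, vset (cycle_graph c1) :&: vset (cycle_graph c2)
      \subset [set z].
    have [z /andP [z1 z2]|no] := pickP [pred z | (z \in c1) && (z \in c2)].
      exists z; apply/subsetP => u; rewrite !inE => /andP [u1' u2'].
      by rewrite (onec u z).
    exists (h 0); apply/subsetP => u; rewrite !inE => u12.
    by have := no u; rewrite /= u12.
  by apply: disjoint_eset inter; apply: simple_cycle_graph.
have [a ha] := visited_cycle lc1 (visE _ ec1).
have [b hb] := visited_cycle lc2 (visE _ ec2).
(* The hole visits both cycles, so its own walk from time [a] to the later time [b + a * L] connects
   them in [X]; hence a shortest connecting path exists. *)
have hpath m : path X (h a) (mkseq (fun i => h (a + i).+1) m) /\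
    last (h a) (mkseq (fun i => h (a + i).+1) m) = h (a + m).
  elim: m => [|m [Xm lm]]; first by rewrite addn0.
  by rewrite mkseqS rcons_path last_rcons Xm lm hX addnS.
have [Xp lp] := hpath (b + a * L - a).
rewrite subnKC in lp; last first.
  by apply: leq_trans (leq_addl _ _); rewrite leq_pmulr // (leq_trans _ L2).
have lp2 : last (h a) (mkseq (fun i => h (a + i).+1) (b + a * L - a)) \in c2.
  by rewrite lp (periodic_hole_mul _ _ pw).
have [x [s [x1 Xs ls mins]]] := shortest_path (A := mem c1) (B := mem c2) ha Xp lp2.
have [t1 [t2 [i [j [e1 e2 ut]]]]] :=
  shortest_path_uniq x1 Xs ls mins onec uc1 uc2.
(* The bound is the length of the commutator walk built from the pulled-back cycles and this
   shortest path, so that walk is no longer than the girth. *)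
have bound := barbell_length_bound symX pw rc lc1 uc1 (visE _ ec1) lc2 uc2
  (visE _ ec2) dis mins.
have sz1 : size c1 = (size t1).+1 by rewrite -(size_rot i) e1.
have sz2 : size c2 = (size t2).+1 by rewrite -(size_rot j) e2.
have [D [gD bD]] : exists D, girth_cycle (graph_of (FS X (@star n))) D /\
    is_barbell (induced D).
  apply: (barbell_girth_cycle symX irrX (hc 0) gL ut) => //.
  - by rewrite sz1 in lc1.
  - by rewrite sz2 in lc2.
  - by rewrite -e1 rot_cycle cycX.
  - by rewrite -e2 rot_cycle cycX.
  - by rewrite -sz1 -sz2.
by exists D; split=> //; right.
Qed.
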